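(* For each $\kappa\in(2\pi,4\pi)$ there exist a value $K^*>0$ and a pair of $C^\infty$ functions $u,K:\mathbb{R}^2\to\mathbb{R}$, radially symmetric and decreasing about some point $x_*\in\mathbb{R}^2$, which jointly solve $$-\Delta u(x)=K(x)e^{2u(x)},\qquad -\Delta K(x)=e^{2u(x)},\qquad x\in\mathbb{R}^2,$$ and for which $\int_{\mathbb{R}^2}K(x)e^{2u(x)}\,dx=\kappa$ and $K(x_* )=K^*$. This solution pair (for these $\kappa$ and $K^*$) is unique up to translations of $x_*$, and scalings $x\mapsto kx$ coupled with the translations $u\mapsto u-\ln k$; that is, if $(v,L)$ is another such pair, radially symmetric and decreasing about $y_*$, with the same integral curvature $\kappa$ and $L(y_* )=K^*$, then there is $k>0$ such that $v(x)=u(x_*+k(x-y_* ))+\ln k$ and $L(x)=K(x_*+k(x-y_* ))$ for all $x\in\mathbb{R}^2$.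
   Context: $\Delta$ is the standard Laplacian on $\mathbb{R}^2$. ''Radially symmetric and decreasing about $x_*$'' means that the function depends only on $|x-x_*|$ and is a decreasing function of $|x-x_*|$. *)

(* Defs.v *)
From HB Require Import structures.
From mathcomp Require Import all_boot all_order all_algebra.
From mathcomp Require Import all_classical all_reals all_analysis.

Set Implicit Arguments.
Unset Strict Implicit.
Unset Printing Implicit Defensive.

Import Order.TTheory GRing.Theory Num.Theory.
Import numFieldNormedType.Exports.

Local Open Scope classical_set_scope.
Local Open Scope ring_scope.

(** The plane is [R * R].  Its library norm is the sup norm, so the Euclidean
    norm is defined separately; both induce the same topology, hence the same
    continuity and directional derivatives. *)
Definition enorm (R : realType) (x : R * R) : R :=
  Num.sqrt (x.1 ^+ 2 + x.2 ^+ 2).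

Definition e1 (R : realType) : R * R := (1, 0).
Definition e2 (R : realType) : R * R := (0, 1).

Definition laplacian (R : realType) (f : R * R -> R) (x : R * R) : R :=
  'D_(e1 R) ('D_(e1 R) f) x + 'D_(e2 R) ('D_(e2 R) f) x.

Fixpoint class_C (R : realType) (n : nat) (f : R * R -> R) : Prop :=
  match n with
  | 0%N => continuous f
  | m.+1 => [/\ continuous f,
      (forall x, derivable f x (e1 R)) /\ (forall x, derivable f x (e2 R)),
      class_C m ('D_(e1 R) f) & class_C m ('D_(e2 R) f)]
  end.

Definition smooth (R : realType) (f : R * R -> R) : Prop :=
  forall n, class_C n f.

(** Read strictly; note that [homo ... /~] reverses the order. *)
Definition radially_decreasing (R : realType) (c : R * R) (f : R * R -> R) :
    Prop :=
  exists phi : R -> R,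
    {in `[0, +oo[ &, {homo phi : s t /~ s < t}} /\
    forall x, f x = phi (enorm (x - c)).

(** Integrability is stated separately because the library integral is total. *)
Record radial_solution (R : realType) (kappa Kstar : R) (u K : R * R -> R)
    (c : R * R) : Prop := RadialSolution {
  u_smooth : smooth u;
  K_smooth : smooth K;
  u_radial : radially_decreasing c u;
  K_radial : radially_decreasing c K;
  u_eq : forall x, - laplacian u x = K x * expR (2 * u x);
  K_eq : forall x, - laplacian K x = expR (2 * u x);
  curvature_integrable :
    (@lebesgue_measure R \x @lebesgue_measure R)%E.-integrable setT
      (fun x => (K x * expR (2 * u x))%:E);
  curvature_integral :
    (\int[@lebesgue_measure R \x @lebesgue_measure R]_x
       (K x * expR (2 * u x))%:E)%E = kappa%:E;
  K_center : K c = Kstar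
}.

(* Main.v *)
Require Import Defs.
From mathcomp Require Import all_boot all_order all_algebra.
From mathcomp Require Import all_classical all_reals all_analysis.
From mathcomp Require Import measurable_realfun ring lra.
Import Order.TTheory GRing.Theory Num.Theory.
Import numFieldNormedType.Exports.
Local Open Scope ring_scope.
Local Open Scope classical_set_scope.
Set Implicit Arguments.
Unset Strict Implicit.
Unset Printing Implicit Defensive.

(** Existence.  Let [t] be the logarithm of the distance to the center,
    [U = u + t], [X = dU/dt], [y = - dK/dt] and [Z = expR (2 * U)].  The radial
    equations become [dX/dt = - K * Z], [dy/dt = Z], [dZ/dt = 2 * X * Z], and
    [X ^+ 2 + y ^+ 2 / 2 + K * Z] is conserved.  Regularity at the center means
    [X -> 1], [y -> 0], [Z -> 0] at [t = -oo], so that the energy is [1], and the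
    integral curvature is [2 * pi * (1 + al)] if [X -> - al] at [t = +oo], where
    then [y -> be] with [be ^+ 2 = 2 * (1 - al ^+ 2)].  Hence [kappa] fixes both
    ends of the orbit.  With [y] as independent variable, the energy
    identity is the second order equation [Z * Z'' - Z' ^+ 2 / 2 = y ^+ 2 - 2] with
    boundary conditions [Z = 0] at [y = 0] and at [y = be], which no longer
    involves the unknown value of [K] at the center.  In the variables [h], [r]
    given by [y = be * p], [p = 1 / (1 + expR (- r))],
    [Z = 2 * be * p * (1 - p) * h ^+ 2], it is
    [4 * h'' = h - (1 - y ^+ 2 / 2) / h ^+ 3] on the whole line, and a solution
    between the constants [al] and [1] is obtained as the largest fixed
    point of a monotone integral operator ([singular_bvp]).  The time is recovered
    from [dt/dr = 1 / (2 * h ^+ 2)], and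
    [K = (1 - X ^+ 2 - y ^+ 2 / 2) / Z] from the energy
    ([exists_scattering_orbit], [exists_radial_profile]).

    Regularity.  As functions of [s = |x| ^+ 2], the profiles satisfy
    [4 * (s * f')' = g]; averaging preserves smoothness up to [s = 0]
    ([half_class_average]), so that the profiles are smooth on [0, +oo[ by
    bootstrap, and then so are the functions on the plane ([smooth_radial]).

    Uniqueness.  A radial solution is determined by the values of [u] and [K] at
    its center, by Gronwall's lemma ([radial_ode_unique]).  The value of [K] is
    given, and the scaling adjusts that of [u]. *)


(** * Calculus *)

Section directional_derivatives.
Context {R : realType} {V : normedModType R}.
Implicit Types (f g : V -> R) (x v : V).

Lemma is_derive_along_line f x v (l : R) :
  is_derive x v f l <-> is_derive (0 : R) 1 (fun t : R => f (t *: v + x)) l.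
Proof.
have E : 'D_v f x = 'D_1 (fun t : R => f (t *: v + x)) 0.
  rewrite /derive; set g1 := fun h => h^-1 *: _; set g2 := fun h => h^-1 *: _.
  suff -> : g1 = g2 by [].
  by apply/funext => h; rewrite /g1 /g2/= addr0 [h *: 1]mulr1 scale0r add0r.
have D : derivable f x v <-> derivable (fun t : R => f (t *: v + x)) 0 1.
  by rewrite derivable1P.
by split => -[d <-]; apply: DeriveDef; [exact/D|rewrite E|exact/D|rewrite E].
Qed.

Lemma is_derive_eqr f x v (l l' : R) : is_derive x v f l -> l = l' ->
  is_derive x v f l'.
Proof. by move=> + <-. Qed.

Lemma is_derive_cstf (c : R) x v : is_derive x v (fun=> c) 0.
Proof. exact: is_derive_cst. Qed.

Lemma is_derive_addf f g x v (df dg : R) : is_derive x v f df ->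
  is_derive x v g dg -> is_derive x v (fun t => f t + g t) (df + dg).
Proof. by move=> ? ?; exact: is_deriveD. Qed.

Lemma is_derive_oppf f x v (df : R) : is_derive x v f df ->
  is_derive x v (fun t => - f t) (- df).
Proof. by move=> ?; exact: is_deriveN. Qed.

Lemma is_derive_mulf f g x v (df dg : R) : is_derive x v f df ->
  is_derive x v g dg -> is_derive x v (fun t => f t * g t) (df * g x + f x *
    dg).
Proof.
move=> ? ?; apply: (@is_derive_eq _ _ _ (f * g)).
by rewrite /GRing.scale/= addrC [g x * df]mulrC.
Qed.

Lemma is_derive_powf f n x v (df : R) : is_derive x v f df ->
  is_derive x v (fun t => f t ^+ n) (n%:R * f x ^+ n.-1 * df).
Proof.
move=> d; rewrite (_ : (fun t => f t ^+ n) = f ^+ n); first exact: is_deriveX.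
by apply/funext => t; elim: n => [|n IH]; rewrite ?expr0 // !exprS IH.
Qed.

Lemma is_derive_compf (h : R -> R) f x v (l df : R) :
  is_derive (f x) 1 h l -> is_derive x v f df ->
  is_derive x v (fun t => h (f t)) (l * df).
Proof.
move=> dh /is_derive_along_line df0; apply/is_derive_along_line.
apply: (@is_derive1_comp R h (fun t : R => f (t *: v + x))) => //.
by rewrite scale0r add0r.
Qed.

End directional_derivatives.

Section calculus.
Context {R : realType}.
Implicit Types (f g : R -> R) (x a b : R).

Lemma is_derive_idf x v : is_derive x v (fun t => t) v.
Proof. exact: is_derive_id. Qed.

Lemma is_derive_invf f x (df : R) : f x != 0 -> is_derive x 1 f df ->
  is_derive x 1 (fun t => (f t)^-1) (- df / f x ^+ 2).
Proof.
move=> fx0 d; have := is_deriveV fx0 d; congr is_derive.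
by rewrite /GRing.scale/= mulNr mulrC mulNr.
Qed.

Lemma is_derive_expf f x (df : R) : is_derive x 1 f df ->
  is_derive x 1 (fun t => expR (f t)) (expR (f x) * df).
Proof. by move=> d; apply: is_derive_compf. Qed.

Lemma is_derive_lnf f x (df : R) : 0 < f x -> is_derive x 1 f df ->
  is_derive x 1 (fun t => ln (f t)) (df / f x).
Proof.
by move=> fx d; rewrite mulrC; apply: is_derive_compf; exact: is_derive1_ln.
Qed.

Lemma is_derive_continuous f x (l : R) : is_derive x 1 f l ->
  {for x, continuous f}.
Proof. by case=> d _; exact/differentiable_continuous/derivable1_diffP. Qed.

Lemma near_is_derive f g x (l : R) : (\forall t \near x, f t = g t) ->
  is_derive x 1 f l -> is_derive x 1 g l.
Proof. exact: near_eq_is_derive. Qed.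

(** Mean value theorem, the endpoints being inside the domain of derivability. *)
Lemma mvt f (df : R -> R) a b : a < b ->
  (forall x, a <= x <= b -> is_derive x 1 f (df x)) ->
  exists2 c, a < c < b & f b - f a = df c * (b - a).
Proof.
move=> ab d; have [||c cab e] := MVT ab (f := f) (df := df).
- by move=> x; rewrite in_itv/= => /andP[? ?]; apply: d; rewrite !ltW.
- apply: derivable_within_continuous => x; rewrite in_itv/= => H.
  by case: (d _ H).
- by exists c => //; rewrite in_itv/= in cab.
Qed.

Lemma mvt_oc f (df : R -> R) a b : a < b ->
  {for b, continuous f} -> f x @[x --> a^'+] --> f a ->
  (forall x, a < x < b -> is_derive x 1 f (df x)) ->
  exists2 c, a < c < b & f b - f a = df c * (b - a).
Proof.
move=> ab cb ca d;
  have [|c cab e] := MVT ab (d : forall x, x \in `]a, b[%R -> is_derive x 1 f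
  (df x)).
- apply/continuous_within_itvP => //; split => //.
    move=> x; rewrite in_itv/= => H; exact: is_derive_continuous (d _ H).
  exact: cvg_at_left_filter.
- by exists c => //; rewrite in_itv/= in cab.
Qed.

Lemma derive_ge0_le f (df : R -> R) a b : a <= b ->
  (forall x, a <= x <= b -> is_derive x 1 f (df x)) ->
  (forall x, a < x < b -> 0 <= df x) -> f a <= f b.
Proof.
rewrite le_eqVlt => /predU1P[->//|ab] d p.
have [c cab e] := mvt ab d.
by rewrite -subr_ge0 e mulr_ge0 ?p// subr_ge0 ltW.
Qed.

Lemma derive_gt0_lt f (df : R -> R) a b : a < b ->
  (forall x, a <= x <= b -> is_derive x 1 f (df x)) ->
  (forall x, a < x < b -> 0 < df x) -> f a < f b.
Proof.
move=> ab d p; have [c cab e] := mvt ab d.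
by rewrite -subr_gt0 e mulr_gt0 ?p// subr_gt0.
Qed.

Lemma derive_norm_le f (df : R -> R) (M : R) a b :
  (forall x, Num.min a b <= x <= Num.max a b -> is_derive x 1 f (df x)) ->
  (forall x, Num.min a b < x < Num.max a b -> `|df x| <= M) ->
  `|f b - f a| <= M * `|b - a|.
Proof.
case: (ltgtP a b) => [ab|ba|->] d p.
- have [c cab ->] := mvt ab d; by rewrite normrM ler_wpM2r// p.
- have [c cab e] := mvt ba d.
  by rewrite distrC e normrM [`|a - b|]distrC ler_wpM2r// p.
- by rewrite !subrr !normr0 mulr0.
Qed.

End calculus.

(** [isd] differentiates an expression along its structure; [derivative] leaves
    the equality of the result with the claimed value. *)
Ltac isd := repeat first
  [ eassumption | eapply is_derive_cstf | eapply is_derive_idf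
  | eapply is_derive_addf | eapply is_derive_oppf | eapply is_derive_mulf
  | eapply is_derive_powf | eapply is_derive_expf ].
Ltac derivative := eapply is_derive_eqr; [isd|cbv beta].


(** * Exponentially weighted primitives *)

(** The primitive of [s |-> expR (m * s) * F s] that vanishes at [-oo], for a
    bounded continuous [F] and [m > 0]. *)
Definition exp_primitive {R : realType} (m : R) (F : R -> R) (r : R) : R :=
  \int[lebesgue_measure]_(s in `]-oo, r]) (expR (m * s) * F s).

Section exp_primitive.
Context {R : realType}.
Notation mu := (@lebesgue_measure R).
Variable m : R.
Hypothesis m0 : 0 < m.
Implicit Types (F G : R -> R) (r C : R).

Let continuous_expM : continuous (fun s : R => expR (m * s)).
Proof.
move=> x; apply: continuous_comp; last exact: continuous_expR.
exact: scaler_continuous.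
Qed.

Lemma cvg_expMNy : expR (- (m * x)) @[x --> +oo%R] --> (0 : R).
Proof.
apply: (cvg_comp (fun x : R => m * x) (fun x => expR (- x))).
  by apply: gt0_cvgMry => //; exact: cvg_id.
exact: cvgr_expR.
Qed.

Lemma integral_exp r :
  (\int[mu]_(s in `]-oo, r]) (expR (m * s))%:E = (expR (m * r) / m)%:E)%E.
Proof.
have cG (A : set R) : {within A, continuous (fun s : R => expR (m * s))}.
  by apply: continuous_subspaceT; exact: continuous_expM.
rewrite -[r]opprK (@ge0_integration_by_substitutionNy _ (fun s => expR (m *
  s)))//.
have D (x : R) : is_derive x 1 (fun x => - (expR (- (m * x)) / m)) (expR (- (m
  * x))).
  derivative.
  by field; rewrite gt_eqF.
rewrite (@ge0_continuous_FTC2y _ _ (fun x => - (expR (- (m * x)) / m)) _ 0)//.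
- by rewrite -EFinB sub0r mulrN !opprK.
- by move=> x _; exact: expR_ge0.
- apply: continuous_subspaceT => x; apply: continuous_comp.
    exact: opp_continuous.
  exact: continuous_expM.
- rewrite -oppr0; apply: cvgN; rewrite -[X in _ --> X](mul0r m^-1).
  by apply: cvgM; [exact: cvg_expMNy|exact: cvg_cst].
- by apply: cvg_at_right_filter; exact: is_derive_continuous (D _).
- by move=> x _; rewrite derive1E (@derive_val _ _ _ _ _ _ _ (D x))/= mulrN.
Qed.

Section bounded_integrand.
Variables (F : R -> R) (C : R).
Hypotheses (cF : continuous F) (F0 : forall s, 0 <= F s) (FC : forall s, F s <=
  C).

Lemma integrable_exp_primitive r :
  mu.-integrable `]-oo, r] (EFin \o (fun s => expR (m * s) * F s)).
Proof.
have mF : measurable_fun setT (fun s : R => expR (m * s) * F s).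
  apply: continuous_measurable_fun => x.
  by apply: cvgM; [exact: continuous_expM|exact: cF].
have C0 : 0 <= C by rewrite (le_trans (F0 0)).
apply/integrableP; split.
  by apply/measurable_EFinP; exact: measurable_funTS mF.
apply: (@le_lt_trans _ _ (\int[mu]_(s in `]-oo, r]) (C%:E * (expR (m *
  s))%:E))%E).
  apply: ge0_le_integral => //.
  - apply/measurable_EFinP; apply: measurableT_comp => //.
    exact: measurable_funTS.
  - apply/measurable_EFinP; apply: measurable_funM => //.
    by apply: measurable_funTS;
      exact: continuous_measurable_fun continuous_expM.
  - move=> x _; rewrite -EFinM lee_fin ger0_norm ?mulr_ge0 ?expR_ge0//.
    by rewrite mulrC ler_wpM2r ?expR_ge0.
rewrite ge0_integralZl_EFin//; last first.
  apply/measurable_EFinP.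
  by apply: measurable_funTS; exact: continuous_measurable_fun continuous_expM.
by rewrite integral_exp -EFinM ltry.
Qed.

Lemma is_derive_exp_primitive r :
  is_derive r 1 (exp_primitive m F) (expR (m * r) * F r).
Proof.
have cf : {for r, continuous (fun s : R => expR (m * s) * F s)}.
  by apply: cvgM; [exact: continuous_expM|exact: cF].
have [||d e] := continuous_FTC1 _ (integrable_exp_primitive (r + 1)) _ cf.
- by rewrite ltrDl.
- by rewrite ltNyr.
- by apply: (DeriveDef d); rewrite -derive1E e.
Qed.

End bounded_integrand.

Lemma exp_primitive_le F G C r : continuous F -> continuous G ->
  (forall s, 0 <= F s) -> (forall s, F s <= G s) -> (forall s, G s <= C) ->
  exp_primitive m F r <= exp_primitive m G r.
Proof.
move=> cF cG F0 FG GC; apply: le_Rintegral => //.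
- by apply: (integrable_exp_primitive (C := C)) => // s; exact: le_trans (GC s).
- apply: (integrable_exp_primitive (C := C)) => // s.
  exact: le_trans (F0 s) (FG s).
- by move=> s _; rewrite ler_wpM2l ?expR_ge0.
Qed.

Lemma exp_primitive_cst C r : 0 <= C ->
  exp_primitive m (fun=> C) r = C * (expR (m * r) / m).
Proof.
move=> C0; rewrite /exp_primitive.
under eq_Rintegral do rewrite mulrC.
rewrite RintegralZl//; last first.
  have := @integrable_exp_primitive (fun=> 1) 1 _ _ _ r.
  rewrite (_ : _ \o _ = EFin \o (fun s : R => expR (m * s))); last first.
    by apply/funext => s /=; rewrite mulr1.
  by apply => //; exact: cst_continuous.
by rewrite /Rintegral integral_exp.
Qed.

End exp_primitive.


(** * A bounded solution of a singular boundary value problem on the line *)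

(** The bounded solution [w] of [m ^+ 2 * w - w'' = F] for a bounded continuous
    [F], and its derivative: the convolution of [F] with the Green function
    [r |-> expR (- m * |r|) / (2 * m)]. *)
Definition green {R : realType} (m : R) (F : R -> R) (r : R) : R :=
  (expR (- (m * r)) * exp_primitive m F r +
   expR (m * r) * exp_primitive m (fun s => F (- s)) (- r)) / (2 * m).
Definition dgreen {R : realType} (m : R) (F : R -> R) (r : R) : R :=
  (expR (m * r) * exp_primitive m (fun s => F (- s)) (- r) -
   expR (- (m * r)) * exp_primitive m F r) / 2.

Section green.
Context {R : realType}.
Variable m : R.
Hypothesis m0 : 0 < m.
Implicit Types (F G : R -> R) (r C : R).

Let continuous_flip F : continuous F -> continuous (fun s : R => F (- s)).
Proof.
by move=> cF x; apply: continuous_comp; [exact: opp_continuous|exact: cF].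
Qed.

Section bounded_integrand.
Variables (F : R -> R) (C : R).
Hypotheses (cF : continuous F) (F0 : forall s, 0 <= F s) (FC : forall s, F s <=
  C).

Let P1 r : is_derive r 1 (exp_primitive m F) (expR (m * r) * F r).
Proof. exact: is_derive_exp_primitive FC r. Qed.

Let P2 r : is_derive r 1 (fun t => exp_primitive m (fun s => F (- s)) (- t))
  (- (expR (- (m * r)) * F r)).
Proof.
have D : is_derive (- r) 1 (exp_primitive m (fun s => F (- s)))
    (expR (m * - r) * F (- - r)).
  apply: (is_derive_exp_primitive m0 (C := C) (F := fun s => F (- s))) => //.
  exact: continuous_flip.
eapply is_derive_eqr.
  by eapply is_derive_compf; [exact: D|isd].
by rewrite opprK !mulrN mulr1.
Qed.

Lemma is_derive_green r : is_derive r 1 (green m F) (dgreen m F r).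
Proof.
rewrite /green; have := P1 r; have := P2 r => d2 d1.
derivative; rewrite /dgreen expRN.
by field; rewrite !gt_eqF ?expR_gt0//.
Qed.

Lemma is_derive_dgreen r :
  is_derive r 1 (dgreen m F) (m ^+ 2 * green m F r - F r).
Proof.
rewrite /dgreen; have := P1 r; have := P2 r => d2 d1.
derivative; rewrite /green expRN.
by field; rewrite !gt_eqF ?expR_gt0//.
Qed.

Lemma dgreen_bound r : `|dgreen m F r| <= C / (2 * m).
Proof.
have C0 : 0 <= C := le_trans (F0 0) (FC 0).
have c0 (D : R) : continuous (fun _ : R => D) by exact: cst_continuous.
have H1 : 0 <= expR (- (m * r)) * exp_primitive m F r <= C / m.
  apply/andP; split.
    rewrite mulr_ge0 ?expR_ge0// -[0](_ : exp_primitive m (fun=> 0) r = 0).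
      exact: (@exp_primitive_le _ _ m0 _ _ C).
    by rewrite exp_primitive_cst// mul0r.
  have := @exp_primitive_le _ _ m0 _ _ C r cF (c0 C) F0 FC (fun=> lexx C).
  rewrite exp_primitive_cst// => H.
  rewrite expRN mulrC ler_pdivrMr ?expR_gt0//.
  by apply: (le_trans H); rewrite mulrA mulrAC.
have H2 : 0 <= expR (m * r) * exp_primitive m (fun s => F (- s)) (- r) <= C / m.
  apply/andP; split.
    rewrite mulr_ge0 ?expR_ge0// -[0](_ : exp_primitive m (fun=> 0) (- r) = 0).
      by apply: (@exp_primitive_le _ _ m0 _ _ C) => //; exact: continuous_flip.
    by rewrite exp_primitive_cst// mul0r.
  have := @exp_primitive_le _ _ m0 _ _ C (- r) (continuous_flip cF) (c0 C)
    (fun=> F0 _) (fun=> FC _) (fun=> lexx C).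
  rewrite exp_primitive_cst// mulrN expRN => H.
  rewrite mulrC -ler_pdivlMr ?expR_gt0//.
  by apply: (le_trans H); rewrite mulrA mulrAC.
rewrite /dgreen normrM [`|2^-1|]ger0_norm ?invr_ge0//.
rewrite (_ : C / (2 * m) = C / m / 2); last by field; rewrite gt_eqF.
rewrite ler_pM2r ?invr_gt0//.
move: H1 H2; set a := expR _ * _; set b := expR _ * _ => /andP[? ?] /andP[? ?].
by rewrite ler_norml; apply/andP; split; lra.
Qed.

End bounded_integrand.

Lemma green_le F G C r : continuous F -> continuous G ->
  (forall s, 0 <= F s) -> (forall s, F s <= G s) -> (forall s, G s <= C) ->
  green m F r <= green m G r.
Proof.
move=> cF cG F0 FG GC; rewrite /green ler_pM2r ?invr_gt0 ?mulr_gt0//.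
apply: lerD; rewrite ler_wpM2l ?expR_ge0//.
  exact: (@exp_primitive_le _ _ m0 _ _ C).
by apply: (@exp_primitive_le _ _ m0 _ _ C) => //; exact: continuous_flip.
Qed.

Lemma green_cst C r : 0 <= C -> green m (fun=> C) r = C / m ^+ 2.
Proof.
move=> C0; rewrite /green !exp_primitive_cst// mulrN !expRN.
by field; rewrite !gt_eqF ?expR_gt0//.
Qed.

End green.


Section singular_bvp.
Context {R : realType}.

Lemma lipschitz_continuous (f : R -> R) (L : R) :
  (forall r s, `|f r - f s| <= L * `|r - s|) -> continuous f.
Proof.
move=> fL x; apply/cvgrPdist_le => e e0.
have [L0|L0] := leP L 0.
  apply: nearW => t; apply: (le_trans (fL x t)).
  by apply: (@le_trans _ _ 0); [rewrite mulr_le0_ge0|exact: ltW].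
have d0 : 0 < L^-1 * e by rewrite mulr_gt0 ?invr_gt0.
have /cvgrPdist_le/(_ _ d0) : (fun t : R => t) t @[t --> x] --> x by exact:
  cvg_id.
by apply: filterS => t xt; apply: (le_trans (fL x t)); rewrite -ler_pdivlMl.
Qed.

(** Adding a large multiple of [x] makes [k / (4 * x ^+ 3)] nondecreasing in [x]
    away from the origin. *)
Lemma singular_term_le (al k x y : R) : 0 < al -> 0 <= k <= 1 -> al <= x -> x
  <= y ->
  k / (4 * x ^+ 3) + 3 / 4 / al ^+ 4 * x <= k / (4 * y ^+ 3) + 3 / 4 / al ^+ 4
    * y.
Proof.
move=> al0 /andP[k0 k1] alx xy.
have x0 : 0 < x by exact: lt_le_trans alx.
have y0 : 0 < y by exact: lt_le_trans xy.
have E (z : R) : (4 * z ^+ 3)^-1 = 4^-1 * z^-1 ^+ 3 by rewrite invfM exprVn.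
rewrite !E -!exprVn.
set A := al^-1; set X := x^-1; set Y := y^-1.
have Y0 : 0 < Y by rewrite invr_gt0.
have YX : Y <= X by rewrite lef_pV2.
have XA : X <= A by rewrite lef_pV2.
have e : X - Y = (y - x) * (X * Y) by rewrite /X /Y; field; rewrite !gt_eqF.
have X0 : 0 < X := lt_le_trans Y0 YX.
have A0 : 0 < A := lt_le_trans X0 XA.
have h1 : X ^+ 2 + X * Y + Y ^+ 2 <= 3 * A ^+ 2 by nra.
have h2 : X * Y <= A ^+ 2 by nra.
have h3 : (X * Y) * (X ^+ 2 + X * Y + Y ^+ 2) <= 3 * A ^+ 4.
  rewrite (_ : 3 * A ^+ 4 = A ^+ 2 * (3 * A ^+ 2)); last by ring.
  by apply: ler_pM => //; [rewrite mulr_ge0// ltW|nra].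
have h4 : X ^+ 3 - Y ^+ 3 <= (y - x) * (3 * A ^+ 4).
  rewrite (_ : X ^+ 3 - Y ^+ 3 = (X - Y) * (X ^+ 2 + X * Y + Y ^+ 2));
    last by ring.
  by rewrite e -mulrA ler_wpM2l// subr_ge0.
have h5 : k * (X ^+ 3 - Y ^+ 3) <= X ^+ 3 - Y ^+ 3.
  rewrite ler_piMl// subr_ge0 lerXn2r// nnegrE ltW//.
nra.
Qed.


Section fixed_point.
Variables (al : R) (k : R -> R).
Hypotheses (al01 : 0 < al < 1) (ck : continuous k)
  (kb : forall r, al ^+ 2 <= k r <= 1).

(* The equation reads [m2 * h - h'' = N h], with [N] nondecreasing; the
   constants [al] and [1] are a subsolution and a supersolution. *)
Let m2 := 4^-1 + 3 / 4 / al ^+ 4.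
Let m := Num.sqrt m2.
Let L := m2 / (2 * m).
Let N (g : R -> R) r := k r / (4 * g r ^+ 3) + 3 / 4 / al ^+ 4 * g r.
(* [L] bounds the slope of [green m F] for [0 <= F <= m2], and [S] is the set of
   the [L]-Lipschitz subsolutions between [al] and [1]. *)
Let bounded (g : R -> R) := forall r, al <= g r <= 1.
Let lip (g : R -> R) := forall r s, `|g r - g s| <= L * `|r - s|.
Let S := [set g | [/\ bounded g, lip g & forall r, g r <= green m (N g) r]].

Let al0 : 0 < al. Proof. by case/andP: al01. Qed.
Let m20 : 0 < m2. Proof. by rewrite addr_gt0 ?invr_gt0// !divr_gt0// exprn_gt0.
  Qed.
Let m0 : 0 < m. Proof. by rewrite sqrtr_gt0. Qed.
Let mE : m ^+ 2 = m2. Proof. by rewrite sqr_sqrtr// ltW. Qed.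

Let L0 : 0 <= L. Proof. by rewrite ltW// divr_gt0// mulr_gt0. Qed.

Let k01 r : 0 <= k r <= 1.
Proof. by have /andP[a ->] := kb r; rewrite (le_trans _ a)// sqr_ge0. Qed.

Let N_le g1 g2 r : al <= g1 r -> g1 r <= g2 r -> N g1 r <= N g2 r.
Proof. by move=> *; exact: singular_term_le. Qed.

Let N_ge g r : bounded g -> al * m2 <= N g r.
Proof.
move=> bg; have /andP[alg _] := bg r.
apply: le_trans (@N_le (fun=> al) g r (lexx _) alg).
have /andP[kr _] := kb r; have /andP[_ al1] := al01.
have H : al / 4 <= k r / (4 * al ^+ 3).
  rewrite ler_pdivlMr ?mulr_gt0 ?exprn_gt0//.
  apply: le_trans kr; rewrite (_ : al / 4 * (4 * al ^+ 3) = al ^+ 2 * al ^+ 2);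
    last by field.
  by rewrite ger_pMr ?exprn_gt0// expr_le1// ltW.
rewrite /N /m2; lra.
Qed.

Let N_le_m2 g r : bounded g -> N g r <= m2.
Proof.
move=> bg; have /andP[alg g1] := bg r.
apply: (le_trans (@N_le g (fun=> 1) r alg g1)).
have /andP[_ k1] := kb r.
by rewrite /N /m2; lra.
Qed.

Let N_ge0 g r : bounded g -> 0 <= N g r.
Proof. by move=> bg; apply: le_trans (N_ge r bg); rewrite mulr_ge0 ?ltW. Qed.

Let continuous_N g : bounded g -> lip g -> continuous (N g).
Proof.
move=> bg /lipschitz_continuous cg x; have /andP[alg _] := bg x.
apply: cvgD; last by apply: cvgM; [exact: cvg_cst|exact: cg].
apply: cvgM; first exact: ck.
apply: cvgV;
  first by rewrite mulf_neq0// gt_eqF// exprn_gt0// (lt_le_trans _ alg).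
apply: cvgM; first exact: cvg_cst.
by apply: (@continuous_comp _ _ _ g (fun y => y ^+ 3));
  [exact: cg|exact: exprn_continuous].
Qed.

Let lip_green g : bounded g -> lip g -> lip (green m (N g)).
Proof.
move=> bg lg r s; have cN := continuous_N bg lg.
apply: (derive_norm_le (df := dgreen m (N g))) => x _.
  by apply: (is_derive_green m0 (C := m2)) => // t;
    [exact: N_ge0|exact: N_le_m2].
by apply: dgreen_bound => // t; [exact: N_ge0|exact: N_le_m2].
Qed.

Let green_N_le g1 g2 r : bounded g1 -> lip g1 -> bounded g2 -> lip g2 ->
  (forall s, g1 s <= g2 s) -> green m (N g1) r <= green m (N g2) r.
Proof.
move=> b1 l1 b2 l2 g12; apply: (green_le m0 (C := m2)).
- exact: continuous_N.
- exact: continuous_N.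
- by move=> s; exact: N_ge0.
- by move=> s; apply: N_le => //; have /andP[] := b1 s.
- by move=> s; exact: N_le_m2.
Qed.

Let S_cst : S (fun=> al).
Proof.
have bc : bounded (fun=> al) by move=> r; rewrite lexx ltW//; case/andP: al01.
have lc : lip (fun=> al) by move=> r s; rewrite subrr normr0 mulr_ge0.
split=> // r.
have gc : green m (fun=> al * m2) r = al.
  by rewrite green_cst ?mE ?mulfK ?gt_eqF// mulr_ge0// ltW.
rewrite -{1}gc; apply: (green_le m0 (C := m2)).
- exact: cst_continuous.
- exact: continuous_N.
- by move=> s; rewrite mulr_ge0 ?ltW.
- by move=> s; exact: N_ge.
- by move=> s; exact: N_le_m2.
Qed.

Let h r := sup [set g r | g in S].

Let has_sup_S r : has_sup [set g r | g in S].
Proof.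
split; first by exists al, (fun=> al).
by exists 1 => _ [g [bg _ _] <-]; have /andP[] := bg r.
Qed.

Let le_h g r : S g -> g r <= h r.
Proof. by move=> Sg; apply: ub_le_sup; [case: (has_sup_S r)|exists g]. Qed.

Let h_le r (M : R) : (forall g, S g -> g r <= M) -> h r <= M.
Proof.
move=> H; apply: ge_sup; first by case: (has_sup_S r).
by move=> _ [g Sg <-]; exact: H.
Qed.

Let bounded_h : bounded h.
Proof.
move=> r; apply/andP; split; first exact: (@le_h (fun=> al)).
by apply: h_le => g [bg _ _]; have /andP[] := bg r.
Qed.

Let lip_h : lip h.
Proof.
have H r s : h r <= h s + L * `|r - s|.
  apply: h_le => g Sg; have [_ lg _] := Sg.
  have := le_h s Sg; have := lg r s; rewrite ler_norml => /andP[_]; lra.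
move=> r s; rewrite ler_norml; apply/andP; split; last by have := H r s; lra.
by have := H s r; rewrite distrC; lra.
Qed.

Let S_h : S h.
Proof.
split=> // r; apply: h_le => g Sg; have [bg lg gg] := Sg.
by apply: (le_trans (gg r)); apply: green_N_le => // s; exact: le_h.
Qed.

Let S_green_h : S (green m (N h)).
Proof.
have [_ _ hg] := S_h.
have bg : bounded (green m (N h)).
  move=> r; apply/andP; split.
    by apply: le_trans (hg r); have /andP[] := bounded_h r.
  have gc : green m (fun=> m2) r = 1.
    by rewrite green_cst ?mE ?divff ?gt_eqF// ltW.
  rewrite -gc; apply: (green_le m0 (C := m2)) => //.
  - exact: continuous_N.
  - exact: cst_continuous.
  - by move=> s; exact: N_ge0.
  - by move=> s; exact: N_le_m2.
split=> //; first exact: lip_green.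
by move=> r; apply: green_N_le => //; exact: lip_green.
Qed.

(** Existence by the Knaster-Tarski argument: [g |-> green m (N g)] is monotone
    and preserves [S], hence fixes the pointwise supremum [h] of [S]. *)
Lemma singular_bvp : exists h h1 : R -> R, forall r,
  [/\ al <= h r <= 1, is_derive r 1 h (h1 r) &
      is_derive r 1 h1 ((h r - k r / h r ^+ 3) / 4)].
Proof.
have hE : h = green m (N h).
  apply/funext => r; apply/eqP; rewrite eq_le; apply/andP; split.
    by case: S_h.
  exact: le_h.
exists h, (dgreen m (N h)) => r.
have cN := continuous_N bounded_h lip_h.
have bN0 s : 0 <= N h s by exact: N_ge0.
have bN s : N h s <= m2 by exact: N_le_m2.
have h0 : h r != 0.
  by rewrite gt_eqF// (lt_le_trans al0)//; have /andP[] := bounded_h r.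
split=> //; first by rewrite {1}hE; exact: (is_derive_green m0 cN bN0 bN).
apply: is_derive_eqr; first exact: (is_derive_dgreen m0 cN bN0 bN).
rewrite -hE mE /N /m2; field.
by rewrite h0 gt_eqF.
Qed.

End fixed_point.

End singular_bvp.


(** * Primitives and limits at infinity *)

Section tools.
Context {R : realType}.

(** The integrand is split by the partition of unity
    [1 / (1 + expR (- s)) + 1 / (1 + expR s)], whose two terms decay at [-oo] and
    at [+oo]. *)
Lemma bounded_antiderivative (f : R -> R) (C : R) : continuous f ->
  (forall r, 0 <= f r <= C) -> exists T : R -> R, forall r : R, is_derive r 1 T
    (f r).
Proof.
move=> cf fb.
pose F g (s : R) : R := g s / (1 + expR s).
have D0 s : 0 < 1 + expR s :> R by rewrite addr_gt0// expR_gt0.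
have cF g : continuous g -> continuous (F g).
  move=> cg x; apply: cvgM; first exact: cg.
  apply: cvgV; first by rewrite gt_eqF.
  by apply: cvgD; [exact: cvg_cst|exact: continuous_expR].
have F0 g s : 0 <= g s <= C -> 0 <= F g s.
  by case/andP => g0 _; rewrite divr_ge0// ltW.
have FC g s : 0 <= g s <= C -> F g s <= C.
  case/andP => g0 gC; rewrite ler_pdivrMr//; apply: (le_trans gC).
  by rewrite ler_peMr// ?(le_trans g0)// lerDl expR_ge0.
have cN : continuous (fun s : R => f (- s)).
  by move=> x; apply: continuous_comp; [exact: opp_continuous|exact: cf].
have d1 (r : R) : is_derive r 1 (exp_primitive 1 (F f)) (expR (1 * r) * F f r).
  by apply: (is_derive_exp_primitive ltr01 (C := C)) => [|s|s];
    [exact: cF|exact: F0|exact: FC].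
have d2 (r : R) : is_derive r 1 (exp_primitive 1 (F (fun s => f (- s))))
    (expR (1 * r) * F (fun s => f (- s)) r).
  by apply: (is_derive_exp_primitive ltr01 (C := C)) => [|s|s];
    [exact: cF|exact: F0|exact: FC].
exists (fun r => exp_primitive 1 (F f) r - exp_primitive 1 (F (fun s => f (-
  s))) (- r)) => r.
have d1r := d1 r.
have d2r : is_derive r 1 (fun t => exp_primitive 1 (F (fun s => f (- s))) (- t))
    (expR (1 * - r) * F (fun s => f (- s)) (- r) * - 1).
  by eapply is_derive_compf; [exact: d2|isd].
derivative; rewrite /F opprK !mul1r !expRN.
have e0 : expR r != 0 by rewrite gt_eqF// expR_gt0.
have e1 : 1 + expR r != 0 by rewrite gt_eqF.
have e2 : expR r + 1 != 0 by rewrite addrC.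
by field; rewrite e0 ?e1 ?e2.
Qed.

(** A derivative bounded by [C * expR r] on the left half-line forces convergence
    at [-oo], with the rate [C * expR r]. *)
Lemma exponential_limit (f df : R -> R) (C : R) :
  (forall r : R, r <= 0 -> is_derive r 1 f (df r)) ->
  (forall r : R, r <= 0 -> `|df r| <= C * expR r) ->
  exists l, forall r : R, r <= 0 -> `|f r - l| <= C * expR r.
Proof.
move=> d b.
have C0 : 0 <= C.
  by have := le_trans (normr_ge0 _) (b 0 (lexx _)); rewrite expR0 mulr1.
have up r s : r <= s -> s <= 0 -> f r + C * expR r <= f s + C * expR s.
  move=> rs s0; apply: (derive_ge0_le (f := fun r => f r + C * expR r)
      (df := fun r => df r + C * expR r)) => // x /andP[_ xs].
    have := d x (le_trans xs s0) => dx; derivative; ring.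
  have := b x (le_trans (ltW xs) s0); rewrite ler_norml => /andP[]; lra.
have dn r s : r <= s -> s <= 0 -> f s - C * expR s <= f r - C * expR r.
  move=> rs s0; rewrite -lerN2;
    apply: (derive_ge0_le (f := fun r => - (f r - C * expR r))
      (df := fun r => - (df r - C * expR r))) => // x /andP[_ xs].
    have := d x (le_trans xs s0) => dx; derivative; ring.
  have := b x (le_trans (ltW xs) s0); rewrite ler_norml => /andP[]; lra.
pose E := [set f r + C * expR r | r in [set r | r <= 0]].
have key r s : r <= 0 -> s <= 0 -> f r - C * expR r <= f s + C * expR s.
  have e t : 0 <= C * expR t by rewrite mulr_ge0// expR_ge0.
  move=> r0 s0; have [rs|sr] := leP r s.
    by have := up _ _ rs s0; have := e r; lra.
  by have := dn _ _ (ltW sr) r0; have := e s; lra.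
have hE : has_inf E.
  split; first by exists (f 0 + C * expR 0), 0 => /=.
  by exists (f 0 - C * expR 0) => _ [s s0 <-]; exact: key.
exists (inf E) => r r0; rewrite ler_norml; apply/andP; split.
  have : inf E <= f r + C * expR r by apply: ge_inf; [case: hE|exists r].
  by lra.
have : f r - C * expR r <= inf E.
  by apply: lb_le_inf; [case: hE|move=> _ [s s0 <-]; exact: key].
by lra.
Qed.

Lemma cvg_expR_Ny : expR x @[x --> -oo] --> (0 : R).
Proof. by apply/cvgNy_compNP; exact: cvgr_expR. Qed.

Lemma exponential_limit_cvg (f : R -> R) (C l : R) :
  (forall r : R, r <= 0 -> `|f r - l| <= C * expR r) -> f r @[r --> -oo] --> l.
Proof.
move=> b; have H : C * expR x @[x --> -oo] --> (0 : R).
  by rewrite -[X in _ --> X](mulr0 C); apply: cvgM;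
    [exact: cvg_cst|exact: cvg_expR_Ny].
apply: (@squeeze_cvgr _ _ _ _ (fun r => l - C * expR r) (fun r => l + C * expR
  r)).
- near=> r; have : `|f r - l| <= C * expR r.
    by apply: b; near: r; exact: nbhs_ninfty_le.
  by rewrite ler_distl.
- by rewrite -[X in _ --> X]subr0; apply: cvgB => //; exact: cvg_cst.
- by rewrite -[X in _ --> X]addr0; apply: cvgD => //; exact: cvg_cst.
Unshelve. all: by end_near. Qed.

Lemma exponential_limity (f df : R -> R) (C : R) :
  (forall s : R, 0 <= s -> is_derive s 1 f (df s)) ->
  (forall s : R, 0 <= s -> `|df s| <= C * expR (- (2^-1 * s))) ->
  exists l : R, f s @[s --> +oo] --> l.
Proof.
move=> d b.
have [||l H] := @exponential_limit (fun r => f (- (2 * r)))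
    (fun r => df (- (2 * r)) * - 2) (2 * C).
- move=> r r0; have s0 : 0 <= - (2 * r) by lra.
  have dr : is_derive r 1 (fun r : R => - (2 * r)) (- 2) by derivative; ring.
  by apply: (@is_derive_compf R R f (fun r => - (2 * r))) dr; exact: d.
- move=> r r0; have s0 : 0 <= - (2 * r) by lra.
  have := b _ s0; rewrite mulrN opprK mulKf// normrM normrN [`|2|]ger0_norm//;
    lra.
exists l.
have cE : expR (- (2^-1 * x)) @[x --> +oo%R] --> (0 : R) by apply: cvg_expMNy;
  rewrite invr_gt0.
apply: (@squeeze_cvgr _ _ _ _ (fun s => l - 2 * C * expR (- (2^-1 * s)))
    (fun s => l + 2 * C * expR (- (2^-1 * s)))).
- near=> s; have s0 : 0 <= s by near: s; exact: nbhs_pinfty_ge.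
  have s0' : - (2^-1 * s) <= 0 by lra.
  by have := H _ s0'; rewrite mulrN opprK mulVKf// ler_distl.
- rewrite -[X in _ --> X]subr0 -[X in _ - X](mulr0 (2 * C)).
  by apply: cvgB; [exact: cvg_cst|apply: cvgM => //; exact: cvg_cst].
- rewrite -[X in _ --> X]addr0 -[X in _ + X](mulr0 (2 * C)).
  by apply: cvgD; [exact: cvg_cst|apply: cvgM => //; exact: cvg_cst].
Unshelve. all: by end_near. Qed.

End tools.


(** * The scattering orbit in logarithmic time *)

(** With [t = T / 2] the logarithm of the radius, [X = dU/dt], [Z = expR (2 * U)]
    and [y = - dK/dt] solve [dX/dt = - K * Z], [dy/dt = Z], [dZ/dt = 2 * X * Z];
    [X ^+ 2 + y ^+ 2 / 2 + K * Z] is a conserved energy.  Here [U = u + t], and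
    the orbit goes from [X = 1], [y = 0] to [X = - al], [y = be].  It is
    parametrized by [r], with [dt/dr = q / 2]; the last five fields are the
    bounds that follow from [y] being [be] times the logistic function of [r]. *)
Record scattering_orbit (R : realType) (al be : R) (T X y Z K q : R -> R) :
  Prop := ScatteringOrbit {
  orbit_q : forall r, 1 <= q r <= al ^- 2;
  orbit_dT : forall r : R, is_derive r 1 T (q r);
  orbit_dX : forall r : R, is_derive r 1 X (- (K r * Z r * q r / 2));
  orbit_dy : forall r : R, is_derive r 1 y (Z r * q r / 2);
  orbit_dZ : forall r : R, is_derive r 1 Z (X r * Z r * q r);
  orbit_dK : forall r : R, is_derive r 1 K (- (y r * q r / 2));
  orbit_Z0 : forall r, 0 < Z r;
  orbit_y0 : forall r, 0 < y r;
  orbit_energy : forall r, X r ^+ 2 + y r ^+ 2 / 2 + K r * Z r = 1;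
  orbit_yNy : forall r, y r <= be * expR r;
  orbit_ZNy : forall r, Z r <= 2 * be * expR r;
  orbit_yy : forall r, be - y r <= be * expR (- r);
  orbit_ybe : forall r, y r <= be;
  orbit_Zy : forall r, Z r <= 2 * be * expR (- r)
}.

Section existence.
Context {R : realType}.
Variables al be : R.
Hypotheses (al01 : 0 < al < 1) (be0 : 0 < be) (beE : be ^+ 2 = 2 * (1 - al ^+
  2)).

(* the logistic function, [p' = p * (1 - p)] *)
Let p (r : R) := (1 + expR (- r))^-1.

Let D0 (r : R) : 0 < 1 + expR (- r) :> R.
Proof. by rewrite addr_gt0// expR_gt0. Qed.

Let p0 r : 0 < p r. Proof. by rewrite invr_gt0. Qed.

Let p1E r : 1 - p r = expR (- r) * p r.
Proof.
rewrite /p; have := D0 r; move: (expR _) => e e0; field.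
by rewrite gt_eqF.
Qed.

Let p1 r : p r < 1.
Proof. by rewrite -subr_gt0 p1E mulr_gt0// expR_gt0. Qed.

Let p_le r : p r <= expR r.
Proof.
rewrite -[X in _ <= X]invrK -expRN lef_pV2 ?posrE ?D0 ?expR_gt0//.
by rewrite lerDr.
Qed.

Let dp (r : R) : is_derive r 1 p (p r * (1 - p r)).
Proof.
have dD : is_derive r 1 (fun r : R => 1 + expR (- r)) (- expR (- r)).
  by derivative; ring.
apply: is_derive_eqr; first by apply: is_derive_invf dD; rewrite gt_eqF.
by rewrite p1E opprK /p; field; rewrite gt_eqF.
Qed.

(** The substitution [Z = 2 * be * p * (1 - p) * h ^+ 2] turns
    [Z * Z'' - Z' ^+ 2 / 2 = y ^+ 2 - 2] (derivatives in [y], vanishing of [Z] at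
    both ends [0] and [be]) into the equation of [singular_bvp], where
    [k = 1 - y ^+ 2 / 2] lies between [al ^+ 2] and [1]. *)
Lemma exists_scattering_orbit :
  exists T X y Z K q : R -> R, scattering_orbit al be T X y Z K q.
Proof.
have [al0 al1] := andP al01.
pose k r := 1 - (1 - al ^+ 2) * p r ^+ 2.
have ck : continuous k.
  move=> x; have dpx := dp x.
  apply: (is_derive_continuous (l := - ((1 - al ^+ 2) * (2 * p x * (p x * (1 -
    p x)))))).
  by rewrite /k; derivative; rewrite /=; ring.
have al21 : al ^+ 2 < 1 by rewrite expr_lt1// ltW.
have kb r : al ^+ 2 <= k r <= 1.
  have h : p r ^+ 2 <= 1 by rewrite expr_le1 ?ltW.
  have h' : 0 <= p r ^+ 2 by rewrite sqr_ge0.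
  by rewrite /k; apply/andP; split; nra.
have [h [h1 H]] := singular_bvp al01 ck kb.
have hb r : al <= h r <= 1 by case: (H r).
have h0 r : 0 < h r by rewrite (lt_le_trans al0)//; case/andP: (hb r).
have dh (r : R) : is_derive r 1 h (h1 r) by case: (H r).
have dh1 (r : R) : is_derive r 1 h1 ((h r - k r / h r ^+ 3) / 4) by case: (H r).
pose q r := (h r)^-1 ^+ 2.
have qb r : 1 <= q r <= al ^- 2.
  have /andP[ah h1'] := hb r; rewrite /q exprVn; apply/andP; split.
    by rewrite invf_ge1 ?exprn_gt0// expr_le1// ltW.
  by rewrite lef_pV2 ?posrE ?exprn_gt0// lerXn2r// nnegrE ltW.
have dhV (r : R) : is_derive r 1 (fun t => (h t)^-1) (- h1 r / h r ^+ 2).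
  by apply: is_derive_invf => //; rewrite gt_eqF.
have cq : continuous q.
  by move=> x; have d := dhV x; eapply is_derive_continuous; rewrite /q; isd.
have qb0 r : 0 <= q r <= al ^- 2.
  by have /andP[q1 ->] := qb r; rewrite (le_trans ler01).
have [T dT] := bounded_antiderivative cq qb0.
pose y r := be * p r.
pose Z r := 2 * be * (p r * (1 - p r)) * h r ^+ 2.
pose X r := (1 - 2 * p r) * h r ^+ 2 + 2 * (h r * h1 r).
pose K r := (1 - X r ^+ 2 - y r ^+ 2 / 2) / Z r.
have Z0 r : 0 < Z r.
  by rewrite /Z !mulr_gt0// ?subr_gt0// exprn_gt0.
have KZ r : K r * Z r = 1 - X r ^+ 2 - y r ^+ 2 / 2.
  by rewrite /K divfK// gt_eqF.
have qE r : q r = (h r)^-1 ^+ 2 by [].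
have dy (r : R) : is_derive r 1 y (Z r * q r / 2).
  have dpr := dp r; rewrite /y; derivative.
  by rewrite /Z /q; field; rewrite gt_eqF.
have dZ (r : R) : is_derive r 1 Z (X r * Z r * q r).
  have dpr := dp r; have dhr := dh r; rewrite /Z; derivative.
  by rewrite /Z /X /q/=; field; rewrite gt_eqF.
have dX (r : R) : is_derive r 1 X (- (K r * Z r * q r / 2)).
  rewrite KZ; have dpr := dp r; have dhr := dh r; have dhr1 := dh1 r.
  rewrite /X; derivative.
  rewrite /X /y exprMn beE /k /q/=; field.
  by rewrite gt_eqF.
have dK (r : R) : is_derive r 1 K (- (y r * q r / 2)).
  have dyr := dy r; have dXr := dX r; have dZr := dZ r.
  have dZV : is_derive r 1 (fun t => (Z t)^-1) (- (X r * Z r * q r) / Z r ^+ 2).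
    by apply: is_derive_invf; rewrite ?gt_eqF.
  rewrite /K; derivative; rewrite /= KZ; field.
  by rewrite gt_eqF.
exists T, X, y, Z, K, q; split=> //.
- by move=> r; rewrite mulr_gt0.
- by move=> r; rewrite KZ; ring.
- by move=> r; rewrite ler_pM2l.
- move=> r; rewrite /Z -mulrA ler_pM2l ?mulr_gt0//.
  have /andP[ah h1'] := hb r.
  have h2 : h r ^+ 2 <= 1 by rewrite expr_le1// ltW.
  have h2' : 0 < h r ^+ 2 by rewrite exprn_gt0.
  have := p_le r; have := p0 r; have := p1 r; move: (expR r) (p r) => e pr.
  by move=> *; apply: (@le_trans _ _ pr) => //; nra.
- by move=> r;
  rewrite /y -{1}[be]mulr1 -mulrBr p1E ler_pM2l// ger_pMr ?expR_gt0// ltW.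
- by move=> r; rewrite /y ger_pMr// ltW.
- move=> r; rewrite /Z -mulrA ler_pM2l ?mulr_gt0//.
  have /andP[ah h1'] := hb r.
  have h2 : h r ^+ 2 <= 1 by rewrite expr_le1// ltW.
  have h2' : 0 < h r ^+ 2 by rewrite exprn_gt0.
  have := p1E r; have := p0 r; have := p1 r; have := expR_gt0 (- r).
  move: (expR (- r)) (p r) => e pr.
  move=> e0 pr1 pr0 E; have le1 : 1 - pr <= e by rewrite E ger_pMr// ltW.
  by apply: (@le_trans _ _ (1 - pr)) => //; nra.
Qed.

End existence.


Section asymptotics.
Context {R : realType}.
Variables (al be : R) (T X y Z K q : R -> R).
Hypotheses (al01 : 0 < al < 1) (be0 : 0 < be) (beE : be ^+ 2 = 2 * (1 - al ^+
  2)).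
Hypothesis O : scattering_orbit al be T X y Z K q.

Let qC := al ^- 2.
Let q1 r : 1 <= q r. Proof. by case/andP: (orbit_q O r). Qed.
Let q0 r : 0 < q r. Proof. exact: lt_le_trans (q1 r). Qed.
Let qle r : q r <= qC. Proof. by case/andP: (orbit_q O r). Qed.
Let qC0 : 0 < qC. Proof. exact: lt_le_trans (qle 0). Qed.
Let Z0 r : 0 < Z r. Proof. exact: orbit_Z0 O r. Qed.
Let y0 r : 0 < y r. Proof. exact: orbit_y0 O r. Qed.
Let al0 : 0 < al. Proof. by case/andP: al01. Qed.

Let cvg0Ny (f : R -> R) (C : R) : (forall r, 0 < f r) ->
  (forall r, f r <= C * expR r) -> f r @[r --> -oo] --> (0 : R).
Proof.
move=> f0 fC; apply: (@exponential_limit_cvg _ _ C) => r _.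
by rewrite subr0 gtr0_norm.
Qed.

Lemma orbit_y_cvgNy : y r @[r --> -oo] --> (0 : R).
Proof. exact: cvg0Ny y0 (orbit_yNy O). Qed.

Lemma orbit_Z_cvgNy : Z r @[r --> -oo] --> (0 : R).
Proof. exact: cvg0Ny Z0 (orbit_ZNy O). Qed.

Lemma orbit_K_decreasing r s : r < s -> K s < K r.
Proof.
move=> rs; rewrite -ltrN2.
apply: (derive_gt0_lt (f := fun t => - K t) (df := fun t => y t * q t / 2)) =>
  //.
  move=> t _; have := orbit_dK O t => d; derivative; ring.
by move=> t _; rewrite divr_gt0// mulr_gt0.
Qed.

Let K_limit : exists Ks, forall r : R, r <= 0 -> `|K r - Ks| <= be * qC / 2 *
  expR r.
Proof.
apply: (exponential_limit (df := fun r => - (y r * q r / 2))).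
  by move=> r _; exact: orbit_dK O r.
move=> r _; rewrite normrN ger0_norm; last by rewrite divr_ge0// ltW// mulr_gt0.
rewrite [leRHS]mulrAC ler_pM2r ?invr_gt0// [leRHS]mulrAC.
by apply: ler_pM (orbit_yNy O r) (qle r); rewrite ltW.
Qed.

Let X_limit : exists2 M : R, 0 <= M & exists Xs, forall r : R, r <= 0 -> `|X r
  - Xs| <= M * expR r.
Proof.
have [Ks HK] := K_limit; pose C : R := `|Ks| + be * qC / 2.
have C0 : 0 <= C by rewrite addr_ge0// divr_ge0// ltW// mulr_gt0.
have KC r : r <= 0 -> `|K r| <= C.
  move=> r0; have := HK r r0; have := ler_normD (K r - Ks) Ks; rewrite subrK.
  have : be * qC / 2 * expR r <= be * qC / 2.
    by rewrite ger_pMr ?divr_gt0 ?mulr_gt0// -expR0 ler_expR.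
  rewrite /C; lra.
exists (C * (2 * be) * qC / 2).
  by rewrite !mulr_ge0// ltW.
apply: (exponential_limit (df := fun r => - (K r * Z r * q r / 2))).
  by move=> r _; exact: orbit_dX O r.
move=> r r0; rewrite normrN !normrM !(gtr0_norm (Z0 _)) (gtr0_norm (q0 _)).
rewrite [`|2^-1|]gtr0_norm ?invr_gt0//.
rewrite [leRHS]mulrAC ler_pM2r ?invr_gt0//.
have KZ : `|K r| * Z r <= C * (2 * be * expR r).
  apply: ler_pM (KC r r0) (orbit_ZNy O r) => //; exact: ltW.
rewrite [leRHS]mulrAC -[C * _ * _]mulrA.
apply: ler_pM KZ (qle r); last exact: ltW.
by rewrite mulr_ge0// ltW.
Qed.

Lemma orbit_X_cvgNy : X r @[r --> -oo] --> (1 : R).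
Proof.
have [Ks HK] := K_limit; have [M M0 [Xs HX]] := X_limit.
have cK := exponential_limit_cvg HK; have cX := exponential_limit_cvg HX.
have cE : X r ^+ 2 + y r ^+ 2 / 2 + K r * Z r @[r --> -oo] --> Xs ^+ 2 + 0 ^+ 2
  / 2 + Ks * 0.
  apply: cvgD; last exact: cvgM orbit_Z_cvgNy.
  apply: cvgD.
    by apply: (cvg_comp _ (fun x => x ^+ 2) cX); exact: exprn_continuous.
  apply: cvgM; last exact: cvg_cst.
  by apply: (cvg_comp _ (fun x => x ^+ 2) orbit_y_cvgNy);
    exact: exprn_continuous.
have : Xs ^+ 2 + 0 ^+ 2 / 2 + Ks * 0 = 1.
  apply: (cvg_unique _ cE) => //=.
  rewrite (_ : (fun r => _) = fun=> 1); first exact: cvg_cst.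
  by apply/funext => r; exact: orbit_energy O r.
rewrite expr0n/= mul0r mulr0 !addr0 => /eqP;
  rewrite sqrf_eq1 => /orP[/eqP<-//|/eqP XsE].
rewrite XsE in cX.
(* [Xs = - 1] is impossible: [Z > 0] would be decreasing near [-oo], where it
   tends to [0] *)
have [r0 [_ Xr0]] : \forall r \near -oo, X r < 0.
  by move/cvgrPdist_lt : cX => /(_ 1 ltr01); apply: filterS => r;
    rewrite ltr_distl; lra.
have Zr0 : \forall r \near -oo, Z r < Z (r0 - 1).
  move/cvgrPdist_lt : orbit_Z_cvgNy => /(_ _ (Z0 (r0 - 1))).
  by apply: filterS => r; rewrite sub0r normrN gtr0_norm.
have [r [rr0 Zr]] : exists r, r <= r0 - 1 /\ Z r < Z (r0 - 1).
  near (-oo : set_system R) => r; exists r; split; near: r => //.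
  exact/nbhs_ninfty_le/num_real.
suff : Z (r0 - 1) <= Z r by rewrite leNgt Zr.
rewrite -lerN2;
  apply: (derive_ge0_le (f := fun t => - Z t) (df := fun t => - (X t * Z t * q
  t))) => //.
  by move=> t _; have := orbit_dZ O t => d; derivative; ring.
move=> t /andP[_ tr]; rewrite oppr_ge0 -mulrA nmulr_rle0 ?mulr_ge0 ?ltW//.
by apply: Xr0; rewrite (lt_trans tr)// ltrBlDr ltrDl.
Unshelve. all: by end_near. Qed.

(** The limit is the value of [u] at the origin. *)
Lemma orbit_u_cvgNy : exists A, (ln (Z r) - T r) / 2 @[r --> -oo] --> (A : R).
Proof.
have [M M0 [Xs HX]] := X_limit.
have XsE : Xs = 1.
  exact: cvg_unique (exponential_limit_cvg HX) orbit_X_cvgNy.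
rewrite XsE in HX.
have [||A HA] := @exponential_limit _ (fun r => (ln (Z r) - T r) / 2)
    (fun r => (X r - 1) * q r / 2) (M * qC / 2).
- move=> r _; have dT := orbit_dT O r; have dZ := orbit_dZ O r.
  have dl : is_derive r 1 (fun t => ln (Z t)) (X r * Z r * q r / Z r).
    exact: is_derive_lnf.
  by derivative; field; rewrite gt_eqF.
- move=> r r0;
  rewrite !normrM (gtr0_norm (q0 _)) [`|2^-1|]gtr0_norm ?invr_gt0//.
  rewrite [leRHS]mulrAC ler_pM2r ?invr_gt0// [leRHS]mulrAC.
  by apply: ler_pM (HX r r0) (qle r) => //; exact: ltW.
exists A; exact: exponential_limit_cvg HA.
Qed.

Lemma orbit_y_cvgy : y r @[r --> +oo] --> be.
Proof.
have cE : be * expR (- r) @[r --> +oo] --> (0 : R).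
  by rewrite -[X in _ --> X](mulr0 be); apply: cvgM;
    [exact: cvg_cst|exact: cvgr_expR].
apply: (@squeeze_cvgr _ _ _ _ (fun r => be - be * expR (- r)) (fun=> be)).
- apply: nearW => r; rewrite (orbit_ybe O) andbT.
  by have := orbit_yy O r; lra.
- by rewrite -[X in _ --> X]subr0; apply: cvgB => //; exact: cvg_cst.
- exact: cvg_cst.
Qed.

(* [K] grows at most linearly, so that half of the decay rate of [Z] survives. *)
Let KZ_decay : exists2 C : R, 0 <= C & forall s : R, 0 <= s ->
  `|K s * Z s| <= C * expR (- (2^-1 * s)).
Proof.
pose C : R := `|K 0| + be * qC.
have C0 : 0 <= C by rewrite addr_ge0// mulr_ge0// ltW.
exists (C * (2 * be)); first by rewrite !mulr_ge0// ltW.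
move=> s s0; set e := expR (2^-1 * s).
have e1 : 1 + 2^-1 * s <= e by exact: expR_ge1Dx.
have e0 : 0 < e by exact: expR_gt0.
have eE : expR (- s) = e^-1 * e^-1.
  by rewrite -expRN -expRD; congr expR; field.
have HK : `|K s| <= C * e.
  have : `|K s - K 0| <= be * qC / 2 * `|s - 0|.
    apply: (derive_norm_le (df := fun r => - (y r * q r / 2))) => r _.
      exact: orbit_dK O r.
    rewrite normrN gtr0_norm ?divr_gt0 ?mulr_gt0// ler_pM2r ?invr_gt0//.
    by apply: ler_pM (orbit_ybe O r) (qle r) => //; exact: ltW.
  rewrite subr0 (ger0_norm s0) => h.
  have := ler_normD (K s - K 0) (K 0); rewrite subrK => h'.
  have h1 : be * qC / 2 * s <= be * qC * e.
    by rewrite -mulrA ler_pM2l ?mulr_gt0//; lra.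
  have h2 : `|K 0| <= `|K 0| * e by rewrite ler_peMr//; lra.
  rewrite /C; lra.
rewrite normrM (gtr0_norm (Z0 _)).
apply: (@le_trans _ _ (C * e * (2 * be * expR (- s)))).
  by apply: ler_pM HK (orbit_Zy O s) => //; exact: ltW.
rewrite eE expRN -/e le_eqVlt; apply/predU1P; left; field.
by rewrite gt_eqF.
Qed.

Lemma orbit_Z_cvgy : Z r @[r --> +oo] --> (0 : R).
Proof.
apply: (@squeeze_cvgr _ _ _ _ (fun=> 0) (fun r => 2 * be * expR (- r))).
- by apply: nearW => r; rewrite (orbit_Zy O) andbT ltW.
- exact: cvg_cst.
- by rewrite -[X in _ --> X](mulr0 (2 * be)); apply: cvgM;
  [exact: cvg_cst|exact: cvgr_expR].
Qed.

Lemma orbit_X_cvgy : X r @[r --> +oo] --> - al.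
Proof.
have [C C0 HC] := KZ_decay.
have [||Xs cX] := @exponential_limity _ X (fun r => - (K r * Z r * q r / 2)) (C
  * qC / 2).
- by move=> s _; exact: orbit_dX O s.
- move=> s s0; rewrite normrN normrM [`|2^-1|]gtr0_norm ?invr_gt0//.
  rewrite [leRHS]mulrAC ler_pM2r ?invr_gt0// normrM (gtr0_norm (q0 _))
    [leRHS]mulrAC.
  by apply: ler_pM (HC s s0) (qle s) => //; exact: ltW.
have cKZ : K r * Z r @[r --> +oo] --> (0 : R).
  have cE : expR (- (2^-1 * x)) @[x --> +oo%R] --> (0 : R).
    by apply: cvg_expMNy; rewrite invr_gt0.
  apply: (@squeeze_cvgr _ _ _ _ (fun s => - (C * expR (- (2^-1 * s))))
    (fun s => C * expR (- (2^-1 * s)))).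
  - near=> s; have s0 : 0 <= s by near: s; exact: nbhs_pinfty_ge.
    by rewrite -ler_norml HC.
  - by rewrite -oppr0 -[X in - X](mulr0 C); apply: cvgN; apply: cvgM => //;
    exact: cvg_cst.
  - by rewrite -[X in _ --> X](mulr0 C); apply: cvgM => //; exact: cvg_cst.
have cE : X r ^+ 2 + y r ^+ 2 / 2 + K r * Z r @[r --> +oo] --> Xs ^+ 2 + be ^+
  2 / 2 + 0.
  apply: cvgD => //; apply: cvgD.
    by apply: (cvg_comp _ (fun x => x ^+ 2) cX); exact: exprn_continuous.
  apply: cvgM; last exact: cvg_cst.
  by apply: (cvg_comp _ (fun x => x ^+ 2) orbit_y_cvgy);
    exact: exprn_continuous.
have : Xs ^+ 2 + be ^+ 2 / 2 + 0 = 1.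
  apply: (cvg_unique _ cE) => //=.
  rewrite (_ : (fun r => _) = fun=> 1); first exact: cvg_cst.
  by apply/funext => r; exact: orbit_energy O r.
rewrite addr0 beE => E; have /eqP : Xs ^+ 2 = al ^+ 2 by lra.
rewrite eqf_sqr => /orP[/eqP XsE|/eqP<-//].
rewrite XsE in cX.
(* [Xs = al] is impossible: [Z > 0] would be increasing near [+oo], where it
   tends to [0] *)
have [r0 [_ Xr0]] : \forall r \near +oo, 0 < X r.
  by move/cvgrPdist_lt : cX => /(_ al al0); apply: filterS => r;
    rewrite ltr_distl; lra.
have Zr0 : \forall r \near +oo, Z r < Z (r0 + 1).
  move/cvgrPdist_lt : orbit_Z_cvgy => /(_ _ (Z0 (r0 + 1))).
  by apply: filterS => r; rewrite sub0r normrN gtr0_norm.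
have [r [rr0 Zr]] : exists r, r0 + 1 <= r /\ Z r < Z (r0 + 1).
  near (+oo : set_system R) => r; exists r; split; near: r => //.
  exact/nbhs_pinfty_ge/num_real.
suff : Z (r0 + 1) <= Z r by rewrite leNgt Zr.
apply: (derive_ge0_le (df := fun t => X t * Z t * q t)) => //.
  by move=> t _; exact: orbit_dZ O t.
move=> t /andP[tr _]; rewrite -mulrA mulr_ge0 ?mulr_ge0 ?ltW//.
by apply: Xr0; rewrite (lt_trans _ tr)// ltrDl.
Unshelve. all: by end_near. Qed.

Let X_increasing r s : r <= s -> (forall t, r < t < s -> K t <= 0) -> X r <= X
  s.
Proof.
move=> rs Kt;
  apply: (derive_ge0_le (df := fun r => - (K r * Z r * q r / 2))) => //.
  by move=> t _; exact: orbit_dX O t.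
by move=> t /Kt Kt0;
  rewrite oppr_ge0 -!mulrA mulr_le0_ge0// mulr_ge0// ?divr_ge0 ?ltW.
Qed.

(** If [X r >= 1], the energy makes [K r] negative; then [K] stays negative and
    [X] keeps increasing, against its limit [- al]. *)
Lemma orbit_X_lt1 r : X r < 1.
Proof.
rewrite ltNge; apply/negP => Xr.
have Kr : K r < 0.
  have : K r * Z r < 0.
    by have := orbit_energy O r; have : 0 < y r ^+ 2 by [rewrite exprn_gt0];
      nra.
  by rewrite pmulr_llt0.
have : 1 <= - al.
  apply: (cvgr_to_ge orbit_X_cvgy); near=> s.
  have rs : r <= s by near: s; exact/nbhs_pinfty_ge/num_real.
  apply: (le_trans Xr); apply: X_increasing => // t /andP[rt _].
  by rewrite ltW// (lt_trans (orbit_K_decreasing rt)).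
by have := al0; lra.
Unshelve. all: by end_near. Qed.

(** If the limit were not positive, [K] would be nonpositive everywhere and [X]
    nondecreasing from its limit [1] at [-oo]. *)
Lemma orbit_K_cvgNy : exists2 Ks, 0 < Ks & K r @[r --> -oo] --> (Ks : R).
Proof.
have [Ks HK] := K_limit; have cK := exponential_limit_cvg HK.
exists Ks => //; rewrite ltNge; apply/negP => Ks0.
have K0 r : K r <= 0.
  apply: le_trans Ks0; apply: (cvgr_to_ge cK); near=> s.
  have sr : s < r by near: s; exact/nbhs_ninfty_lt/num_real.
  exact/ltW/orbit_K_decreasing.
have : (1 : R) <= X 0.
  apply: (cvgr_to_le orbit_X_cvgNy); near=> s.
  have s0 : s <= 0 by near: s; exact: nbhs_ninfty_le.
  by apply: X_increasing => // t _; exact: K0.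
by rewrite leNgt orbit_X_lt1.
Unshelve. all: by end_near. Qed.

End asymptotics.


(** * The radial profile *)

(** The profiles [a] of [u] and [b] of [K] as functions of [s = |x|^2], extended
    continuously to the whole line.  The auxiliary functions are
    [x = 1 + 2 * s * a'] and [y = - 2 * s * b']. *)
Record radial_profile (R : realType) (al be Ks : R) (a b x y : R -> R) : Prop
  := RadialProfile {
  profile_a : continuous a;
  profile_b : continuous b;
  profile_x : continuous x;
  profile_y : continuous y;
  profile_Ks : 0 < Ks;
  profile_b0 : b 0 = Ks;
  profile_x0 : x 0 = 1;
  profile_y0 : y 0 = 0;
  profile_xy : x s @[s --> +oo] --> - al;
  profile_yy : y s @[s --> +oo] --> be;
  profile_da : forall s : R, 0 < s -> is_derive s 1 a ((x s - 1) / (2 * s));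
  profile_db : forall s : R, 0 < s -> is_derive s 1 b (- y s / (2 * s));
  profile_dx : forall s : R, 0 < s -> is_derive s 1 x (- (b s * expR (2 * a s))
    / 2);
  profile_dy : forall s : R, 0 < s -> is_derive s 1 y (expR (2 * a s) / 2);
  profile_x1 : forall s, 0 < s -> x s < 1;
  profile_ygt0 : forall s, 0 < s -> 0 < y s
}.

Section profile.
Context {R : realType}.

Lemma continuous_extension (f : R -> R) :
  (forall s, s <= 0 -> f s = f 0) -> f s @[s --> 0^'+] --> f 0 ->
  (forall s, 0 < s -> {for s, continuous f}) -> continuous f.
Proof.
move=> fN f0 fp s; have [s0|s0|->] := ltgtP s 0; last 1 first.
- apply/left_right_continuousP; split=> //.
  apply: cvg_near_cst; near=> t.
  have t0 : t <= 0 by near: t; exact: nbhs_left_le.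
  by rewrite [f t]fN.
- apply: cvg_near_cst; near=> t.
  have t0 : t < 0 by near: t; exact: lt_nbhsl.
  by rewrite [f s]fN ?(ltW s0)// [f t]fN// ltW.
- exact: fp.
Unshelve. all: by end_near. Qed.

Lemma increasing_bijection (T q : R -> R) : (forall r : R, is_derive r 1 T (q
  r)) ->
  (forall r, 1 <= q r) -> exists G : R -> R, [/\ cancel T G, cancel G T &
    forall s : R, is_derive s 1 G (q (G s))^-1].
Proof.
move=> dT q1.
have Tinc r s : r < s -> T r < T s.
  by move=> rs; apply: (derive_gt0_lt (df := q)) => // t _;
    exact: lt_le_trans (q1 t).
have Tr r s : r <= s -> T r - r <= T s - s.
  move=> rs;
    apply: (derive_ge0_le (f := fun r => T r - r) (df := fun r => q r - 1)) =>
    //.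
  by move=> t _; rewrite subr_ge0.
have cT : continuous T by move=> r; exact: is_derive_continuous (dT r).
have surj s : exists r, T r = s.
  have [|||r _ E] := @IVT R T (- `|s - T 0|) `|s - T 0| s.
  - by have := normr_ge0 (s - T 0); lra.
  - exact: continuous_subspaceT.
  - have n0 := normr_ge0 (s - T 0).
    have h1 := Tr 0 `|s - T 0| n0.
    have h2 : - `|s - T 0| <= 0 by lra.
    have h3 := Tr _ _ h2.
    have h4 := ler_norm (s - T 0); have h5 := lerNnormlW (lexx `|s - T 0|).
    by rewrite ge_min le_max; apply/andP; split; apply/orP; [left|right]; lra.
  - by exists r.
have /choice[G GK] := surj.
have TK : cancel T G.
  move=> r; have := GK (T r); have [/Tinc|/Tinc|//] := ltgtP (G (T r)) r.
    by move=> + E; rewrite E ltxx.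
  by move=> + E; rewrite E ltxx.
exists G; split=> // s.
rewrite -{1}(GK s); apply: is_derive_inverse.
- by near=> t; exact: TK.
- by near=> t; exact: cT.
- by rewrite gt_eqF// (lt_le_trans ltr01).
Unshelve. all: by end_near. Qed.


Lemma exists_radial_profile (al be : R) :
  0 < al < 1 -> 0 < be -> be ^+ 2 = 2 * (1 - al ^+ 2) ->
  exists (Ks : R) (a b x y : R -> R), radial_profile al be Ks a b x y.
Proof.
move=> al01 be0 beE.
have [T [X [y [Z [K [q O]]]]]] := exists_scattering_orbit al01 be0 beE.
have q1 r : 1 <= q r by case/andP: (orbit_q O r).
have q0 r : q r != 0 by rewrite gt_eqF// (lt_le_trans ltr01).
have [G [TK GK dG]] := increasing_bijection (orbit_dT O) q1.
have Tinc r s : r < s -> T r < T s.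
  move=> rs; apply: (derive_gt0_lt (df := q)) => // t _;
    last exact: lt_le_trans (q1 t).
  exact: orbit_dT O t.
have Gmono r s : T r < s -> r < G s.
  move=> rs; rewrite ltNge; apply/negP; rewrite le_eqVlt => /predU1P[E|/Tinc].
    by rewrite -E GK ltxx in rs.
  by rewrite GK ltNge (ltW rs).
have Gmono' r s : s < T r -> G s < r.
  move=> rs; rewrite ltNge; apply/negP; rewrite le_eqVlt => /predU1P[E|/Tinc].
    by rewrite E GK ltxx in rs.
  by rewrite GK ltNge (ltW rs).
have cGNy : G (ln s) @[s --> 0^'+] --> -oo.
  apply/cvgrNyPlt => M; near=> s; apply: Gmono'.
  have s0 : 0 < s by near: s; exact: nbhs_right_gt.
  rewrite -ltr_expR lnK ?posrE//; near: s; apply: nbhs_right_lt;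
    exact: expR_gt0.
have cGy : G (ln s) @[s --> +oo] --> +oo.
  apply/cvgryPgt => M; near=> s; apply: Gmono.
  have s1 : expR (T M) < s by near: s; exact/nbhs_pinfty_gt/num_real.
  by rewrite -ltr_expR lnK// posrE (lt_trans _ s1)// expR_gt0.
(* the profile, as a function of [s], of a quantity known along the orbit *)
pose pull (F : R -> R) (l s : R) := if s <= 0 then l else F (G (ln s)).
have pullE F l s : 0 < s -> pull F l s = F (G (ln s)).
  by move=> s0; rewrite /pull leNgt s0.
have pull0 F l : pull F l 0 = l by rewrite /pull lexx.
have dpull (F : R -> R) (l s df : R) : 0 < s -> is_derive (G (ln s)) 1 F df ->
    is_derive s 1 (pull F l) (df / q (G (ln s)) / s).
  move=> s0 dF; apply: (near_is_derive (f := fun s => F (G (ln s)))).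
    by near=> t; rewrite pullE//; near: t; exact: lt_nbhsr.
  apply: is_derive_eqr.
    have dl := is_derive_compf (dG (ln s)) (is_derive1_ln s0).
    exact: is_derive_compf dF dl.
  by rewrite mulrA.
have cpull (F : R -> R) (l : R) : (forall r : R, exists df, is_derive r 1 F df)
  ->
    F r @[r --> -oo] --> l -> continuous (pull F l).
  move=> dF cF; apply: continuous_extension.
  - by move=> s s0; rewrite pull0 /pull s0.
  - rewrite pull0; have := cvg_comp _ _ cGNy cF; apply: cvg_trans.
    apply: near_eq_cvg; near=> t; rewrite pullE//; near: t;
      exact: nbhs_right_gt.
  - move=> s s0; have [df d] := dF (G (ln s)).
    exact: is_derive_continuous (dpull F l s df s0 d).
have cpully (F : R -> R) (l l' : R) : F r @[r --> +oo] --> l' ->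
    pull F l s @[s --> +oo] --> l'.
  move=> cF; have := cvg_comp _ _ cGy cF; apply: cvg_trans.
  apply: near_eq_cvg; near=> t; rewrite pullE//; near: t;
    exact/nbhs_pinfty_gt/num_real.
have [As cA] := orbit_u_cvgNy al01 be0 O.
have [Ks Ks0 cK] := orbit_K_cvgNy al01 be0 beE O.
pose A r := (ln (Z r) - T r) / 2.
have dA (r : R) : is_derive r 1 A ((X r - 1) * q r / 2).
  have dT := orbit_dT O r; have dZ := orbit_dZ O r.
  have dl : is_derive r 1 (fun t => ln (Z t)) (X r * Z r * q r / Z r).
    by apply: is_derive_lnf => //; exact: orbit_Z0 O r.
  by rewrite /A; derivative; field; rewrite gt_eqF// (orbit_Z0 O).
have AE s : 0 < s -> expR (2 * A (G (ln s))) = Z (G (ln s)) / s.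
  move=> s0; rewrite /A mulrC divfK// expRB lnK ?posrE ?(orbit_Z0 O)//.
  by rewrite GK lnK.
exists Ks, (pull A As), (pull K Ks), (pull X 1), (pull y 0); split=> //.
- by apply: cpull => // r; eexists; exact: dA.
- by apply: cpull => // r; eexists; exact: orbit_dK O r.
- apply: cpull; last exact: orbit_X_cvgNy al01 be0 O.
  by move=> r; eexists; exact: orbit_dX O r.
- apply: cpull; last exact: orbit_y_cvgNy O.
  by move=> r; eexists; exact: orbit_dy O r.
- by apply: cpully; exact: orbit_X_cvgy al01 be0 beE O.
- by apply: cpully; exact: orbit_y_cvgy O.
- move=> s s0; apply: is_derive_eqr; first exact: dpull s0 (dA _).
  by rewrite !pullE//; field; rewrite q0 gt_eqF.
- move=> s s0; apply: is_derive_eqr; first exact: dpull s0 (orbit_dK O _).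
  by rewrite !pullE//; field; rewrite q0 gt_eqF.
- move=> s s0; apply: is_derive_eqr; first exact: dpull s0 (orbit_dX O _).
  by rewrite !pullE// AE//; field; rewrite q0 gt_eqF.
- move=> s s0; apply: is_derive_eqr; first exact: dpull s0 (orbit_dy O _).
  by rewrite !pullE// AE//; field; rewrite q0 gt_eqF.
- by move=> s s0; rewrite pullE// (orbit_X_lt1 al01 be0 beE O).
- by move=> s s0; rewrite pullE// (orbit_y0 O).
Unshelve. all: by end_near. Qed.

End profile.


(** * Smoothness up to the origin *)

Section half_line.
Context {R : realType}.
Implicit Types (f g m : R -> R) (n : nat).

(** [f] is of class C^n on [0, +oo[, its derivatives being extended continuously
    to the whole line. *)
Fixpoint half_class n f : Prop :=
  match n with
  | 0%N => continuous f
  | n'.+1 => continuous f /\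
      exists f1 : R -> R, (forall s : R, 0 < s -> is_derive s 1 f (f1 s)) /\
        half_class n' f1
  end.

Lemma half_class_continuous n f : half_class n f -> continuous f.
Proof. by case: n => [//|n] []. Qed.

Lemma half_classW n f : half_class n.+1 f -> half_class n f.
Proof.
elim: n f => [|n IH] f [cf [f1 [d h]]]; first by [].
by split=> //; exists f1; split=> //; exact: IH.
Qed.

Lemma half_class_cst n (c : R) : half_class n (fun=> c).
Proof.
elim: n c => [|n IH] c /=; first exact: cst_continuous.
split; first exact: cst_continuous.
by exists (fun=> 0); split => // s _; exact: is_derive_cstf.
Qed.

Lemma half_classD n f g : half_class n f -> half_class n g ->
  half_class n (fun s => f s + g s).
Proof.
elim: n f g => [|n IH] f g; first by move=> cf cg s; apply: cvgD;
  [exact: cf|exact: cg].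
move=> [cf [f1 [df h1]]] [cg [g1 [dg h2]]]; split.
  by move=> s; apply: cvgD; [exact: cf|exact: cg].
exists (fun s => f1 s + g1 s); split; last exact: IH.
by move=> s s0; apply: is_derive_addf; [exact: df|exact: dg].
Qed.

Lemma half_classM n f g : half_class n f -> half_class n g ->
  half_class n (fun s => f s * g s).
Proof.
elim: n f g => [|n IH] f g; first by move=> cf cg s; apply: cvgM;
  [exact: cf|exact: cg].
move=> hf hg; have hf' := half_classW hf; have hg' := half_classW hg.
move: hf hg => [cf [f1 [df h1]]] [cg [g1 [dg h2]]]; split.
  by move=> s; apply: cvgM; [exact: cf|exact: cg].
exists (fun s => f1 s * g s + f s * g1 s); split.
  by move=> s s0; apply: is_derive_mulf; [exact: df|exact: dg].
by apply: half_classD; exact: IH.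
Qed.

Lemma half_class_exp n f : half_class n f -> half_class n (fun s => expR (f s)).
Proof.
have ce f' : continuous f' -> continuous (fun s => expR (f' s)).
  by move=> cf s; apply: continuous_comp; [exact: cf|exact: continuous_expR].
elim: n f => [|n IH] f; first exact: ce.
move=> hf; have hf' := half_classW hf; move: hf => [cf [f1 [df h1]]].
split; first exact: ce.
exists (fun s => expR (f s) * f1 s); split.
  by move=> s s0; apply: is_derive_expf; exact: df.
by apply: half_classM => //; exact: IH.
Qed.

Lemma continuous_glue f g : continuous g -> (forall s, s <= 0 -> f s = g s) ->
  f s @[s --> 0^'+] --> f 0 -> (forall s, 0 < s -> {for s, continuous f}) ->
  continuous f.
Proof.
move=> cg fg f0 fp.
pose h s := if s <= 0 then 0 else f s - g s.
have hE s : f s = h s + g s.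
  by rewrite /h; case: leP => s0; rewrite ?subrK// add0r fg.
have h0 : h 0 = 0 by rewrite /h lexx.
have ch : continuous h.
  apply: continuous_extension => [s s0|| s s0].
  - by rewrite h0 /h s0.
  - rewrite h0; have : f s - g s @[s --> 0^'+] --> f 0 - g 0.
      by apply: cvgB => //; apply: cvg_at_right_filter; exact: cg.
    rewrite fg// subrr; apply: cvg_trans; apply: near_eq_cvg; near=> s.
    have s0 : 0 < s by near: s; exact: nbhs_right_gt.
    by rewrite /h leNgt s0.
  - have H : f t - g t @[t --> s] --> f s - g s.
      by apply: cvgB; [exact: fp|exact: cg].
    have hs : f s - g s = h s by rewrite /h leNgt s0.
    rewrite hs in H; apply: cvg_trans H.
    apply: near_eq_cvg; near=> t.
    have t0 : 0 < t by near: t; exact: lt_nbhsr.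
    by rewrite /h leNgt t0.
have -> : f = (fun s => h s + g s) by apply/funext.
by move=> s; apply: cvgD; [exact: ch|exact: cg].
Unshelve. all: by end_near. Qed.

(** The regular solution [m] of [s * m' + (n + 1) * m = g], that is the average of
    [g] on [0, s] with weight [s ^+ n], is as smooth as [g] up to the origin: its
    derivative solves the same equation with [n + 1] and [g'] in place of [n] and
    [g], and its continuity at [0] is L'Hopital's rule. *)
Lemma half_class_average j n g m : half_class j g ->
  (forall s : R, 0 < s -> is_derive s 1 m ((g s - n.+1%:R * m s) / s)) ->
  s ^+ n.+1 * m s @[s --> 0^'+] --> 0 ->
  (forall s, s <= 0 -> m s = g s / n.+1%:R) ->
  half_class j m.
Proof.
elim: j n g m => [|j IH] n g m hg dm m0 mN.
  have n0 : n.+1%:R != 0 :> R by rewrite pnatr_eq0.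
  apply: (@continuous_glue _ (fun s => g s / n.+1%:R)) => //.
  - by move=> s; apply: cvgM; [exact: hg|exact: cvg_cst].
  - have dP (s : R) : 0 < s -> is_derive s 1 (fun s => s ^+ n.+1 * m s) (s ^+ n
    * g s).
      move=> s0; have d := dm s s0; derivative; rewrite /= exprS.
      by field; rewrite gt_eqF.
    have dS (s : R) : is_derive s 1 (fun s => s ^+ n.+1) (n.+1%:R * s ^+ n).
      by derivative; rewrite /= mulr1.
    have : s ^+ n.+1 * m s / s ^+ n.+1 @[s --> 0^'+] --> m 0.
      apply: (@lhopital_at_right R _ (fun s => s ^+ n * g s) _
        (fun s => n.+1%:R * s ^+ n) 0 1) => //.
      + by move=> s; rewrite in_itv/= => /andP[s0 _]; exact: dP.
      + apply: cvg_at_right_filter; rewrite -[X in _ --> X](expr0n R n.+1).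
        exact: exprn_continuous.
      + move=> s; rewrite in_itv/= => /andP[s0 _].
        by rewrite mulf_neq0// expf_neq0// gt_eqF.
      + rewrite mN//.
        have : g s / n.+1%:R @[s --> 0^'+] --> g 0 / n.+1%:R.
          by apply: cvg_at_right_filter; apply: cvgM;
            [exact: hg|exact: cvg_cst].
        apply: cvg_trans; apply: near_eq_cvg; near=> s.
        have s0 : s != 0 by rewrite gt_eqF//; near: s; exact: nbhs_right_gt.
        by rewrite [n.+1%:R * _]mulrC invfM mulrACA divff ?mul1r// expf_neq0.
    apply: cvg_trans; apply: near_eq_cvg; near=> s.
    have s0 : s != 0 by rewrite gt_eqF//; near: s; exact: nbhs_right_gt.
    by rewrite mulrAC divff ?mul1r// expf_neq0.
  - by move=> s s0; exact: is_derive_continuous (dm s s0).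
have [cg [g1 [dg h1]]] := hg.
pose m1 s := if s <= 0 then g1 s / n.+2%:R else (g s - n.+1%:R * m s) / s.
have m1E s : 0 < s -> m1 s = (g s - n.+1%:R * m s) / s.
  by move=> s0; rewrite /m1 leNgt s0.
split; first exact: half_class_continuous (IH n g m (half_classW hg) dm m0 mN).
exists m1; split; first by move=> s s0; rewrite m1E//; exact: dm.
apply: (IH n.+1 g1) => //.
- move=> s s0; rewrite m1E//.
  apply: (near_is_derive (f := fun s => (g s - n.+1%:R * m s) / s)).
    by near=> t; rewrite m1E//; near: t; exact: lt_nbhsr.
  have d1 := dg s s0; have d2 := dm s s0.
  have d3 : is_derive s 1 (fun t : R => t^-1) (- 1 / s ^+ 2).
    by apply: (is_derive_invf (f := fun t => t)); rewrite ?gt_eqF//;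
      exact: is_derive_idf.
  derivative; rewrite -[n.+2%:R]natr1; field.
  by rewrite gt_eqF.
- have : s ^+ n.+1 * g s - n.+1%:R * (s ^+ n.+1 * m s) @[s --> 0^'+] --> 0.
    rewrite -[X in _ --> X](subrr 0) -[X in X - _](mul0r (g 0)) -[X in _ -
      X](mulr0 n.+1%:R).
    apply: cvgB; last by apply: cvgM; [exact: cvg_cst|].
    apply: cvg_at_right_filter; apply: cvgM; last exact: cg.
    rewrite -[X in _ --> X](expr0n R n.+1); exact: exprn_continuous.
  apply: cvg_trans; apply: near_eq_cvg; near=> s.
  have s0 : 0 < s by near: s; exact: nbhs_right_gt.
  by rewrite m1E// [s ^+ n.+2]exprS; field; rewrite gt_eqF.
- by move=> s s0; rewrite /m1 s0.
Unshelve. all: by end_near. Qed.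

End half_line.


(** * Radial functions on the plane *)

Section plane.
Context {R : realType}.
Implicit Types (f g : R * R -> R) (z v : R * R).

Lemma is_derive_fstf z v : is_derive z v (fun z => z.1) v.1.
Proof.
by apply/is_derive_along_line => /=; derivative; rewrite /GRing.scale/=; ring.
Qed.

Lemma is_derive_sndf z v : is_derive z v (fun z => z.2) v.2.
Proof.
by apply/is_derive_along_line => /=; derivative; rewrite /GRing.scale/=; ring.
Qed.

(** The square of the Euclidean norm. *)
Definition sqnorm z : R := z.1 ^+ 2 + z.2 ^+ 2.

Lemma sqnorm_ge0 z : 0 <= sqnorm z.
Proof. by rewrite addr_ge0 ?sqr_ge0. Qed.

Lemma is_derive_sqnorm z v :
  is_derive z v sqnorm (2 * (z.1 * v.1 + z.2 * v.2)).
Proof.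
rewrite /sqnorm; have d1 := is_derive_fstf z v; have d2 := is_derive_sndf z v.
by derivative; rewrite /=; ring.
Qed.

Lemma continuous_sqnorm : continuous sqnorm.
Proof.
move=> z; apply: cvgD.
  by apply: (@continuous_comp _ _ _ fst (fun x : R => x ^+ 2));
    [exact: cvg_fst|exact: exprn_continuous].
by apply: (@continuous_comp _ _ _ snd (fun x : R => x ^+ 2));
  [exact: cvg_snd|exact: exprn_continuous].
Qed.

Lemma is_derive_radial (a a1 : R -> R) z v : continuous a -> continuous a1 ->
  (forall s : R, 0 < s -> is_derive s 1 a (a1 s)) ->
  is_derive z v (fun z => a (sqnorm z)) (a1 (sqnorm z) * (2 * (z.1 * v.1 + z.2
    * v.2))).
Proof.
move=> ca ca1 da.
(* [a] is replaced by its affine extension, which is differentiable at [0] *)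
pose g s := if s <= 0 then a1 0 else (a s - a 0) / s.
pose b s := a 0 + g s * s.
have bE s : 0 <= s -> b s = a s.
  rewrite /b /g; case: ltgtP => // [s0|<-] _; last by rewrite mulr0 addr0.
  by rewrite divfK ?gt_eqF// addrC subrK.
have db0 : is_derive (0 : R) 1 b (a1 0).
  apply/is_derive1_caratheodory; exists g; split.
  - by move=> s; rewrite /b mulr0 addr0 subr0 addrC addKr.
  - apply: (@continuous_glue _ _ (fun=> a1 0)).
    + exact: cst_continuous.
    + by move=> s s0; rewrite /g s0.
    + have -> : g 0 = a1 0 by rewrite /g lexx.
      have : (a s - a 0) / s @[s --> 0^'+] --> a1 0.
        apply: (@lhopital_at_right R _ a1 _ (fun=> 1) 0 1) => //.
        * move=> s; rewrite in_itv/= => /andP[s0 _].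
          by have d := da s s0; derivative; ring.
        * rewrite -[X in _ --> X](subrr (a 0)); apply: cvgB;
          last exact: cvg_cst.
          by apply: cvg_at_right_filter; exact: ca.
        * by apply: cvg_at_right_filter; exact: cvg_id.
        * by under eq_fun do rewrite divr1; apply: cvg_at_right_filter;
          exact: ca1.
      apply: cvg_trans; apply: near_eq_cvg; near=> s.
      have s0 : 0 < s by near: s; exact: nbhs_right_gt.
      by rewrite /g leNgt s0.
    + move=> s s0; have H : (a t - a 0) / t @[t --> s] --> (a s - a 0) / s.
        apply: cvgM; first by apply: cvgB; [exact: ca|exact: cvg_cst].
        by apply: cvgV; [rewrite gt_eqF|exact: cvg_id].
      have gs : (a s - a 0) / s = g s by rewrite /g leNgt s0.
      rewrite gs in H; apply: cvg_trans H; apply: near_eq_cvg; near=> t.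
      have t0 : 0 < t by near: t; exact: lt_nbhsr.
      by rewrite /g leNgt t0.
  - by rewrite /g lexx.
have db (s : R) : 0 <= s -> is_derive s 1 b (a1 s).
  rewrite le_eqVlt => /predU1P[<-//|s0]; apply: near_is_derive (da s s0).
  by near=> t; rewrite bE// ltW//; near: t; exact: lt_nbhsr.
rewrite (_ : (fun z => _) = fun z => b (sqnorm z)).
  by apply: is_derive_compf (is_derive_sqnorm z v); exact: db (sqnorm_ge0 z).
by apply/funext => w; rewrite bE// sqnorm_ge0.
Unshelve. all: by end_near. Qed.

Lemma class_CD n f g : class_C n f -> class_C n g -> class_C n (fun z => f z +
  g z).
Proof.
elim: n f g => [|n IH] f g; first by move=> cf cg z; apply: cvgD;
  [exact: cf|exact: cg].
move=> [cf [f1 f2] cf1 cf2] [cg [g1 g2] cg1 cg2].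
have D v : (forall z, derivable f z v) -> (forall z, derivable g z v) ->
    'D_v (fun z => f z + g z) = fun z => 'D_v f z + 'D_v g z.
  by move=> df dg; apply/funext => z; exact: deriveD.
split.
- by move=> z; apply: cvgD; [exact: cf|exact: cg].
- by split=> z; apply: derivableD.
- by rewrite (D _ f1 g1); exact: (IH _ _ cf1 cg1).
- by rewrite (D _ f2 g2); exact: (IH _ _ cf2 cg2).
Qed.

Lemma class_CZ n (c : R) f : class_C n f -> class_C n (fun z => c * f z).
Proof.
elim: n f => [|n IH] f; first by move=> cf z; apply: cvgM;
  [exact: cvg_cst|exact: cf].
move=> [cf [f1 f2] cf1 cf2].
have D v : (forall z, derivable f z v) -> 'D_v (fun z => c * f z) = fun z => c
  * 'D_v f z.
  by move=> df; apply/funext => z; exact: deriveZ.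
split.
- by move=> z; apply: cvgM; [exact: cvg_cst|exact: cf].
- by split=> z; apply: derivableZ.
- by rewrite (D _ f1); exact: (IH _ cf1).
- by rewrite (D _ f2); exact: (IH _ cf2).
Qed.

(** The monomials make the family stable under partial derivatives. *)
Lemma class_C_monomial_radial n i j (a : R -> R) : half_class n a ->
  class_C n (fun z => z.1 ^+ i * z.2 ^+ j * a (sqnorm z)).
Proof.
have C k l b : continuous b -> continuous (fun z : R * R => z.1 ^+ k * z.2 ^+ l
  * b (sqnorm z)).
  move=> cb z; apply: cvgM; last first.
    by apply: continuous_comp; [exact: continuous_sqnorm|exact: cb].
  apply: cvgM.
    by apply: (@continuous_comp _ _ _ fst (fun x : R => x ^+ k));
      [exact: cvg_fst|exact: exprn_continuous].
  by apply: (@continuous_comp _ _ _ snd (fun x : R => x ^+ l));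
    [exact: cvg_snd|exact: exprn_continuous].
elim: n i j a => [|n IH] i j a; first exact: C.
move=> ha; have ha' := half_classW ha; move: ha => [ca [a1 [da ha1]]].
have ca1 := half_class_continuous ha1.
have D z v : is_derive z v (fun z => z.1 ^+ i * z.2 ^+ j * a (sqnorm z))
   (v.1 * (i%:R * (z.1 ^+ i.-1 * z.2 ^+ j * a (sqnorm z)) +
      2 * (z.1 ^+ i.+1 * z.2 ^+ j * a1 (sqnorm z))) +
    v.2 * (j%:R * (z.1 ^+ i * z.2 ^+ j.-1 * a (sqnorm z)) +
      2 * (z.1 ^+ i * z.2 ^+ j.+1 * a1 (sqnorm z)))).
  have d1 := is_derive_fstf z v; have d2 := is_derive_sndf z v.
  have d3 := is_derive_radial z v ca ca1 da.
  by derivative; rewrite /= !exprS; ring.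
have E1 : 'D_(e1 R) (fun z => z.1 ^+ i * z.2 ^+ j * a (sqnorm z)) =
    fun z => i%:R * (z.1 ^+ i.-1 * z.2 ^+ j * a (sqnorm z)) +
      2 * (z.1 ^+ i.+1 * z.2 ^+ j * a1 (sqnorm z)).
  by apply/funext => z; have [_ ->] := D z (e1 R); rewrite /= mul1r mul0r addr0.
have E2 : 'D_(e2 R) (fun z => z.1 ^+ i * z.2 ^+ j * a (sqnorm z)) =
    fun z => j%:R * (z.1 ^+ i * z.2 ^+ j.-1 * a (sqnorm z)) +
      2 * (z.1 ^+ i * z.2 ^+ j.+1 * a1 (sqnorm z)).
  by apply/funext => z; have [_ ->] := D z (e2 R); rewrite /= mul1r mul0r add0r.
split.
- exact: C.
- by split=> z; [case: (D z (e1 R))|case: (D z (e2 R))].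
- by rewrite E1; apply: class_CD; apply: class_CZ; exact: IH.
- by rewrite E2; apply: class_CD; apply: class_CZ; exact: IH.
Qed.

Lemma smooth_radial (a : R -> R) : (forall n, half_class n a) ->
  smooth (fun z => a (sqnorm z)).
Proof.
move=> ha n;
  rewrite (_ : (fun z => _) = fun z : R * R => z.1 ^+ 0 * z.2 ^+ 0 * a (sqnorm
  z)).
  exact: class_C_monomial_radial.
by apply/funext => z; rewrite !expr0 !mul1r.
Qed.

Lemma laplacian_radial (a a1 a2 : R -> R) z : continuous a -> continuous a1 ->
  continuous a2 -> (forall s : R, 0 < s -> is_derive s 1 a (a1 s)) ->
  (forall s : R, 0 < s -> is_derive s 1 a1 (a2 s)) ->
  laplacian (fun z => a (sqnorm z)) z =
  4 * a1 (sqnorm z) + 4 * sqnorm z * a2 (sqnorm z).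
Proof.
move=> ca ca1 ca2 da da1.
have D1 v : 'D_v (fun z => a (sqnorm z)) =
    fun z => a1 (sqnorm z) * (2 * (z.1 * v.1 + z.2 * v.2)).
  by apply/funext => w; have [_ ->] := is_derive_radial w v ca ca1 da.
have D2 v w : 'D_v (fun z => a1 (sqnorm z) * (2 * (z.1 * v.1 + z.2 * v.2))) w =
    a2 (sqnorm w) * (2 * (w.1 * v.1 + w.2 * v.2)) ^+ 2 +
    a1 (sqnorm w) * (2 * (v.1 ^+ 2 + v.2 ^+ 2)).
  have d1 := is_derive_fstf w v; have d2 := is_derive_sndf w v.
  have d3 := is_derive_radial w v ca1 ca2 da1.
  apply: derive_val; derivative; rewrite /=; ring.
by rewrite /laplacian !D1 !D2 /= /sqnorm; ring.
Qed.

End plane.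


Section poisson.
Context {R : realType}.

Section radial_poisson.
Variables f w g : R -> R.
Hypotheses (cf : continuous f) (cw : continuous w) (w0 : w 0 = 0).
Hypothesis df : forall s : R, 0 < s -> is_derive s 1 f (w s / (2 * s)).
Hypothesis dw : forall s : R, 0 < s -> is_derive s 1 w (2 * g s).

Let m s := if s <= 0 then g s else w s / (2 * s).

Let mE s : 0 < s -> m s = w s / (2 * s).
Proof. by move=> s0; rewrite /m leNgt s0. Qed.

Let dfm (s : R) : 0 < s -> is_derive s 1 f (m s).
Proof. by move=> s0; rewrite mE//; exact: df. Qed.

Let dm (s : R) : 0 < s -> is_derive s 1 m ((g s - 1%:R * m s) / s).
Proof.
move=> s0; rewrite mE//.
apply: (near_is_derive (f := fun s => w s * (2 * s)^-1)).
  by near=> t; rewrite mE//; near: t; exact: lt_nbhsr.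
have d1 := dw s0.
have d2 : is_derive s 1 (fun t : R => (2 * t)^-1) (- 2 / (2 * s) ^+ 2).
  apply: is_derive_invf; first by rewrite mulf_neq0// gt_eqF.
  by derivative; ring.
by derivative; field; rewrite gt_eqF.
Unshelve. all: by end_near. Qed.

Let half_class_m n : half_class n g -> half_class n m.
Proof.
move=> hg; apply: (half_class_average hg dm).
  have : w s / 2 @[s --> 0^'+] --> w 0 / 2.
    by apply: cvg_at_right_filter; apply: cvgM; [exact: cw|exact: cvg_cst].
  rewrite w0 mul0r; apply: cvg_trans; apply: near_eq_cvg; near=> s.
  have s0 : 0 < s by near: s; exact: nbhs_right_gt.
  by rewrite mE// expr1; field; rewrite gt_eqF.
by move=> s s0; rewrite divr1 /m s0.
Unshelve. all: by end_near. Qed.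

(** With [w = 2 * s * f'], the hypotheses say that [(s * f')' = g]; this is the
    radial form of [laplacian f = 4 * g], and [f] gains one derivative over [g]. *)
Lemma half_class_poisson n : half_class n g -> half_class n.+1 f.
Proof. by move=> hg; split=> //; exists m; split=> //; exact: half_class_m. Qed.

Lemma laplacian_poisson z : half_class 1 g ->
  laplacian (fun z => f (sqnorm z)) z = 4 * g (sqnorm z).
Proof.
move=> hg; have [cm [m1 [dm1 cm1]]] := half_class_m hg.
rewrite (laplacian_radial z cf cm cm1 dfm dm1).
have := sqnorm_ge0 z; rewrite le_eqVlt => /predU1P[<-|s0].
  by rewrite /m lexx; ring.
have -> : m1 (sqnorm z) = (g (sqnorm z) - 1%:R * m (sqnorm z)) / sqnorm z.
  by have [_ <-] := dm1 _ s0; have [_ <-] := dm s0.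
by field; rewrite gt_eqF.
Qed.

End radial_poisson.

Section profile_solution.
Variables (al be Ks : R) (a b x y : R -> R).
Hypothesis P : radial_profile al be Ks a b x y.

(* a quarter of the Laplacians of [u] and [K] *)
Let ga s := - (b s * expR (2 * a s)) / 4.
Let gb s := - expR (2 * a s) / 4.

Let cx1 : continuous (fun s => x s - 1).
Proof. by move=> s; apply: cvgB; [exact: (profile_x P)|exact: cvg_cst]. Qed.
Let cy1 : continuous (fun s => - y s).
Proof. by move=> s; apply: cvgN; exact: (profile_y P). Qed.
Let x10 : x 0 - 1 = 0. Proof. by rewrite (profile_x0 P) subrr. Qed.
Let y10 : - y 0 = 0. Proof. by rewrite (profile_y0 P) oppr0. Qed.
Let dx1 (s : R) : 0 < s -> is_derive s 1 (fun s => x s - 1) (2 * ga s).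
Proof.
by move=> s0; have d := profile_dx P s0; derivative; rewrite /ga; field.
Qed.
Let dy1 (s : R) : 0 < s -> is_derive s 1 (fun s => - y s) (2 * gb s).
Proof.
by move=> s0; have d := profile_dy P s0; derivative; rewrite /gb; field.
Qed.

Let half_class_sources n : half_class n a -> half_class n b ->
  half_class n ga /\ half_class n gb.
Proof.
move=> ha hb.
have he : half_class n (fun s => expR (2 * a s)).
  by apply: half_class_exp; apply: half_classM => //; exact: half_class_cst.
have hc (c : R) f : half_class n f -> half_class n (fun s => - f s / c).
  move=> hf; rewrite (_ : (fun s => _) = fun s => f s * - c^-1).
    by apply: half_classM => //; exact: half_class_cst.
  by apply/funext => s; rewrite mulNr mulrN.
by split; apply: hc => //; exact: half_classM.
Qed.

(** Bootstrap: both right-hand sides are smooth functions of [a] and [b]. *)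
Lemma half_class_profile n : half_class n a /\ half_class n b.
Proof.
elim: n => [|n [ha hb]]; first by split;
  [exact: profile_a P|exact: profile_b P].
have [hga hgb] := half_class_sources ha hb; split.
- by apply: (half_class_poisson (profile_a P) cx1 x10 (profile_da P) dx1 hga).
- by apply: (half_class_poisson (profile_b P) cy1 y10 (profile_db P) dy1 hgb).
Qed.

Lemma laplacian_profile z :
  - laplacian (fun z => a (sqnorm z)) z = b (sqnorm z) * expR (2 * a (sqnorm
    z)) /\
  - laplacian (fun z => b (sqnorm z)) z = expR (2 * a (sqnorm z)).
Proof.
have [ha hb] := half_class_profile 1;
  have [hga hgb] := half_class_sources ha hb.
split.
- rewrite (laplacian_poisson (profile_a P) cx1 x10 (profile_da P) dx1 z hga)
  /ga.
  by field.
- rewrite (laplacian_poisson (profile_b P) cy1 y10 (profile_db P) dy1 z hgb)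
  /gb.
  by field.
Qed.

End profile_solution.

Lemma radially_decreasing_sqnorm (f df : R -> R) : continuous f ->
  (forall s : R, 0 < s -> is_derive s 1 f (df s)) -> (forall s, 0 < s -> df s <
    0) ->
  radially_decreasing 0 (fun z => f (sqnorm z)).
Proof.
move=> cf d dn; exists (fun r => f (r ^+ 2)); split; last first.
  by move=> z; rewrite /enorm subr0 sqr_sqrtr// sqnorm_ge0.
have dec s t : 0 <= s -> s < t -> f t < f s.
  move=> s0 st; have [||| c /andP[sc ct] E] := @mvt_oc R f df s t st.
  - exact: cf.
  - by apply: cvg_at_right_filter; exact: cf.
  - by move=> r /andP[sr _]; apply: d; exact: le_lt_trans sr.
  - by rewrite -subr_lt0 E nmulr_rlt0 ?subr_gt0// dn// (le_lt_trans s0).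
move=> r s; rewrite !in_itv/= !andbT => r0 s0 rs.
by apply: dec; rewrite ?sqr_ge0// ltrXn2r.
Qed.

End poisson.


(** * Integration of radial functions *)

Section radial_integral.
Context {R : realType}.
Notation mu := (@lebesgue_measure R).

Lemma integral_scale (f : R -> R) (c : R) : (0 < c)%R -> continuous f ->
  (forall t, 0 <= f t)%R ->
  (\int[mu]_t (f t)%:E = \int[mu]_t (f (c * t)%R * c)%R%:E)%E.
Proof.
move=> c0 cf f0.
have d (t : R) : is_derive t 1%R (fun t => c * t)%R c by derivative; ring.
have dE : (fun t : R => c * t)^`() = cst c.
  by apply/funext => t; rewrite derive1E derive_val.
rewrite (@increasing_ge0_integration_by_substitutionT _ (fun t => c * t)%R f)//.
- by apply: eq_integral => t _; rewrite dE.
- by move=> s t st; rewrite ltr_pM2l.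
- by rewrite dE => t; exact: cst_continuous.
- by rewrite dE; exact: is_cvg_cst.
- by rewrite dE; exact: is_cvg_cst.
- by apply: gt0_cvgMrNy => //; exact: cvg_id.
- by apply: gt0_cvgMry => //; exact: cvg_id.
Qed.

Let mf2 (f : R -> R) : measurable_fun setT f ->
  measurable_fun [set: R * R] (fun z => f (sqnorm z)).
Proof.
move=> mf; apply: measurableT_comp => //.
by apply: measurable_funD; apply: measurable_funX;
  [exact: measurable_fst|exact: measurable_snd].
Qed.

(** Integration in polar coordinates, the radial integral being expressed by a
    primitive [P] of [f].  The coordinates are the abscissa and the slope of the
    line through the origin instead of the radius and the angle. *)
Lemma integral_radial (f P : R -> R) (L : R) : continuous f ->
  (forall s, 0 <= s -> 0 <= f s) -> continuous P ->
  (forall s : R, (0 < s)%R -> is_derive s 1%R P (f s)) ->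
  P s @[s --> +oo%R] --> L ->
  (\int[mu \x mu]_z (f (sqnorm z))%:E)%E = (pi * (L - P 0))%:E.
Proof.
move=> cf f0 cP dP PL.
have mf : measurable_fun setT f by exact: continuous_measurable_fun.
pose q (t : R) := (1 + t ^+ 2)%R.
have q0 t : (0 < q t)%R by rewrite ltr_wpDr ?sqr_ge0.
pose H (z : R * R) := (f (z.1 ^+ 2 * q z.2) * `|z.1|)%R.
have xq z : 0 <= z.1 ^+ 2 * q z.2 by rewrite mulr_ge0 ?sqr_ge0// ltW.
have H0 z : 0 <= H z by rewrite mulr_ge0// f0.
have mH : measurable_fun setT H.
  apply: measurable_funM; last first.
    by apply: measurableT_comp => //; exact: measurable_fst.
  apply: measurableT_comp => //; apply: measurable_funM.
    by apply: measurable_funX; exact: measurable_fst.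
  apply: measurable_funD => //; apply: measurable_funX; exact: measurable_snd.
have csq (x : R) : continuous (fun t : R => f (x ^+ 2 + t ^+ 2)%R).
  move=> t; apply: continuous_comp; last exact: cf.
  by apply: cvgD; [exact: cvg_cst|exact: exprn_continuous].
(* [y = |x| * t], for [x] away from the null set {0} *)
have slice (x : R) : (x != 0)%R ->
    (\int[mu]_t (f (sqnorm (x, t)))%:E = \int[mu]_t (H (x, t))%:E)%E.
  move=> x0;
    rewrite /sqnorm/= (@integral_scale (fun t => f (x ^+ 2 + t ^+ 2)%R)
    `|x|%R)//; last 2 first.
  - by rewrite normr_gt0.
  - by move=> t; apply: f0; rewrite addr_ge0 ?sqr_ge0.
  apply: eq_integral => t _; congr EFin; rewrite /H/=; congr (f _ * _)%R.
  by rewrite /q exprMn real_normK ?num_real//; ring.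
have mfs : measurable_fun setT (fun z : R * R => (f (sqnorm z))%:E).
  by apply/measurable_EFinP; exact: mf2.
have mHs : measurable_fun setT (fun z : R * R => (H z)%:E) by
  apply/measurable_EFinP.
have fs0 (z : R * R) : (0 <= (f (sqnorm z))%:E)%E by rewrite lee_fin f0//
  sqnorm_ge0.
have Hs0 (z : R * R) : (0 <= (H z)%:E)%E by rewrite lee_fin.
rewrite (@fubini_tonelli1 _ _ _ _ _ mu mu _ mfs fs0).
have -> : (\int[mu]_x fubini_F mu (fun z : R * R => (f (sqnorm z))%:E) x =
    \int[mu]_x fubini_F mu (fun z : R * R => (H z)%:E) x)%E.
  have mD : measurable ([set: R] `\ (0%R : R)) by exact: measurableD.
  rewrite -[LHS](@integral_setD1 _ _ 0%R)//; last first.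
    by apply: measurable_funTS; exact: measurable_fun_fubini_tonelli_F.
  rewrite -[RHS](@integral_setD1 _ _ 0%R)//; last first.
    by apply: measurable_funTS; exact: measurable_fun_fubini_tonelli_F.
  by apply: eq_integral => x; rewrite inE => -[_ /eqP x0]; exact: slice.
rewrite [LHS](@fubini_tonelli _ _ _ _ _ mu mu _ mHs Hs0).
have PL0 : (0 <= L - P 0)%R.
  rewrite subr_ge0; apply: (cvgr_to_ge PL); near=> s.
  have s0 : (0 < s)%R by near: s; exact/nbhs_pinfty_gt/num_real.
  have [||| c /andP[c0 _] E] := @mvt_oc R P f 0 s s0.
  - exact: cP.
  - by apply: cvg_at_right_filter; exact: cP.
  - by move=> r /andP[r0 _]; exact: dP.
  - by rewrite -subr_ge0 E mulr_ge0 ?subr_ge0 ?f0// ltW.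
have inner (t : R) : (\int[mu]_x (H (x, t))%:E)%E = ((L - P 0) / q t)%:E.
  have cq (x : R) : {for x, continuous (fun x : R => x ^+ 2 * q t)%R}.
    by apply: cvgM; [exact: exprn_continuous|exact: cvg_cst].
  have cH : continuous (fun x : R => H (x, t)).
    move=> x; apply: cvgM; last exact: norm_continuous.
    by apply: continuous_comp; [exact: cq|exact: cf].
  rewrite (@ge0_symfun_integralT _ (fun x => H (x, t)))//; last first.
    by move=> x; rewrite /H/= sqrrN normrN.
  have cF : continuous (fun x : R => P (x ^+ 2 * q t) / (2 * q t))%R.
    move=> x; apply: cvgM; last exact: cvg_cst.
    by apply: continuous_comp; [exact: cq|exact: cP].
  have dF (x : R) : (0 < x)%R ->
      is_derive x 1%R (fun x : R => P (x ^+ 2 * q t) / (2 * q t))%R (H (x, t)).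
    move=> x0;
      have d1 : is_derive x 1%R (fun x : R => x ^+ 2 * q t)%R (2 * x * q t).
      by derivative; rewrite /=; ring.
    have d2 : is_derive x 1%R (fun x : R => P (x ^+ 2 * q t))%R
        (f (x ^+ 2 * q t) * (2 * x * q t)).
      by apply: is_derive_compf d1; apply: dP; rewrite mulr_gt0// exprn_gt0.
    derivative; rewrite /H/= gtr0_norm//; field.
    by rewrite gt_eqF.
  rewrite (_ : [set x : R | (0 <= x)%R] = `[0%R, +oo[%classic); last first.
    by apply/seteqP; split=> x /=; rewrite in_itv/= andbT.
  rewrite (@ge0_continuous_FTC2y _ _ (fun x : R => P (x ^+ 2 * q t) / (2 * q
    t))%R _ (L / (2 * q t))%R).
  - rewrite -EFinB -EFinM; congr EFin; rewrite expr0n/= mul0r; field.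
    by rewrite gt_eqF.
  - by move=> x _; exact: H0.
  - exact: continuous_subspaceT.
  - apply: cvgM; last exact: cvg_cst.
    apply: (cvg_comp (fun x : R => x ^+ 2 * q t)%R P _ PL).
    by apply: gt0_cvgMly => //; exact: cvgr_expr2.
  - by move=> x x0; case: (dF x x0).
  - by apply: cvg_at_right_filter; exact: cF.
  - by move=> x; rewrite in_itv/= andbT => x0; rewrite derive1E;
    case: (dF x x0).
under eq_integral do rewrite inner EFinM.
have cV : continuous (fun t => (q t)^-1)%R.
  move=> t; apply: cvgV; first by rewrite gt_eqF.
  by apply: cvgD; [exact: cvg_cst|exact: exprn_continuous].
rewrite ge0_integralZl_EFin//; last 2 first.
- by move=> t _; rewrite lee_fin invr_ge0 ltW.
- by apply/measurable_EFinP; exact: continuous_measurable_fun.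
rewrite (@ge0_symfun_integralT _ (fun t => (q t)^-1)%R)//; last 2 first.
- by move=> t; rewrite invr_ge0 ltW.
- by move=> t; rewrite /q/= sqrrN.
rewrite (_ : [set x : R | (0 <= x)%R] = `[0%R, +oo[%classic); last first.
  by apply/seteqP; split=> x /=; rewrite in_itv/= andbT.
rewrite integral0y_oneDsqr -!EFinM; congr EFin; field.
Unshelve. all: by end_near. Qed.

End radial_integral.


Section curvature.
Context {R : realType}.
Notation mu := (@lebesgue_measure R).
Variables (al be Ks : R) (a b x y : R -> R).
Hypothesis P : radial_profile al be Ks a b x y.

Let b_le s : 0 <= s -> b s <= Ks.
Proof.
rewrite -(profile_b0 P) le_eqVlt => /predU1P[<-//|s0].
have [||| c /andP[c0 _] E] := @mvt_oc R b (fun s => - y s / (2 * s)) 0 s s0.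
- exact: (profile_b P).
- by apply: cvg_at_right_filter; exact: (profile_b P).
- by move=> r /andP[r0 _]; exact: profile_db P r r0.
- rewrite -subr_le0 E mulr_le0_ge0 ?subr_ge0 ?(ltW s0)// mulNr oppr_le0.
  by rewrite divr_ge0 ?mulr_ge0// ltW// (profile_ygt0 P).
Qed.

Let ca s : {for s, continuous (fun s => expR (2 * a s))}.
Proof.
apply: continuous_comp; last exact: continuous_expR.
by apply: cvgM; [exact: cvg_cst|exact: (profile_a P)].
Qed.

(* The curvature density is the difference of two nonnegative densities, both of
   which have explicit primitives. *)
Let f1 s := Ks * expR (2 * a s).
Let f2 s := (Ks - b s) * expR (2 * a s).

Let cf1 : continuous f1.
Proof. by move=> s; apply: cvgM; [exact: cvg_cst|exact: ca]. Qed.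
Let cf2 : continuous f2.
Proof.
move=> s; apply: cvgM; last exact: ca.
by apply: cvgB; [exact: cvg_cst|exact: (profile_b P)].
Qed.
Let f10 s : 0 <= s -> 0 <= f1 s.
Proof. by move=> _; rewrite mulr_ge0 ?expR_ge0// ltW// (profile_Ks P). Qed.
Let f20 s : 0 <= s -> 0 <= f2 s.
Proof. by move=> s0; rewrite mulr_ge0 ?expR_ge0// subr_ge0 b_le. Qed.

Let I1 : (\int[mu \x mu]_z (f1 (sqnorm z))%:E)%E = (pi * (2 * Ks * be - 2 * Ks
  * y 0))%:E.
Proof.
apply: (@integral_radial _ f1 (fun s => 2 * Ks * y s)) => //.
- by move=> s; apply: cvgM; [exact: cvg_cst|exact: (profile_y P)].
- by move=> s s0; have d := profile_dy P s0; derivative; rewrite /f1; field.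
- by apply: cvgM; [exact: cvg_cst|exact: profile_yy P].
Qed.

Let I2 : (\int[mu \x mu]_z (f2 (sqnorm z))%:E)%E =
  (pi * (2 * Ks * be + 2 * - al - (2 * Ks * y 0 + 2 * x 0)))%:E.
Proof.
apply: (@integral_radial _ f2 (fun s => 2 * Ks * y s + 2 * x s)) => //.
- move=> s; apply: cvgD; apply: cvgM; try exact: cvg_cst.
    exact: (profile_y P).
  exact: (profile_x P).
- move=> s s0; have d := profile_dy P s0; have d' := profile_dx P s0.
  by derivative; rewrite /f2; field.
- apply: cvgD; apply: cvgM; try exact: cvg_cst.
    exact: profile_yy P.
  exact: profile_xy P.
Qed.

Let integrable_radial (f : R -> R) (l : R) : continuous f -> (forall s, 0 <= s
  -> 0 <= f s) ->
  (\int[mu \x mu]_z (f (sqnorm z))%:E)%E = l%:E ->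
  (mu \x mu)%E.-integrable setT (fun z => (f (sqnorm z))%:E).
Proof.
move=> cf f0 I; apply/integrableP; split.
  apply/measurable_EFinP; apply: measurableT_comp;
    first exact: continuous_measurable_fun.
  by apply: measurable_funD; apply: measurable_funX;
    [exact: measurable_fst|exact: measurable_snd].
under eq_integral do rewrite /= ger0_norm ?f0 ?sqnorm_ge0//.
by rewrite I ltry.
Qed.

Let cE : (fun z => (b (sqnorm z) * expR (2 * a (sqnorm z)))%:E) =
  (fun z => (f1 (sqnorm z))%:E - (f2 (sqnorm z))%:E)%E.
Proof.
by apply/funext => z; rewrite -EFinB /f1 /f2; congr EFin; ring.
Qed.

Lemma integrable_curvature : (mu \x mu)%E.-integrable setT
  (fun z => (b (sqnorm z) * expR (2 * a (sqnorm z)))%:E).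
Proof.
rewrite cE; apply: integrableB => //.
  exact: integrable_radial I1.
exact: integrable_radial I2.
Qed.

Lemma integral_curvature :
  (\int[mu \x mu]_z (b (sqnorm z) * expR (2 * a (sqnorm z)))%:E)%E =
  (2 * pi * (1 + al))%:E.
Proof.
rewrite cE integralB//; last 2 first.
- exact: integrable_radial I1.
- exact: integrable_radial I2.
rewrite I1 I2 (profile_x0 P) (profile_y0 P) -EFinB; congr EFin; ring.
Qed.

End curvature.


(** * Uniqueness of the radial initial value problem *)

(** [g] and [l] are the radial restrictions of a solution [u], [K] of the system,
    with derivatives [g1] and [l1]. *)
Record radial_ode (R : realType) (g g1 l l1 : R -> R) : Prop := RadialODE {
  ode_dg : forall r : R, is_derive r 1 g (g1 r);
  ode_dl : forall r : R, is_derive r 1 l (l1 r);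
  ode_cg1 : continuous g1;
  ode_cl1 : continuous l1;
  ode_g10 : g1 0 = 0;
  ode_l10 : l1 0 = 0;
  ode_dg1 : forall r : R, 0 < r ->
    is_derive r 1 g1 (- (g1 r / r) - l r * expR (2 * g r));
  ode_dl1 : forall r : R, 0 < r -> is_derive r 1 l1 (- (l1 r / r) - expR (2 * g
    r))
}.

Section uniqueness.
Context {R : realType}.

Lemma expR_lipschitz (N x y : R) : x <= N -> y <= N ->
  `|expR x - expR y| <= expR N * `|x - y|.
Proof.
move=> xN yN; apply: (derive_norm_le (df := expR)) => t.
move=> /andP[_ tM]; rewrite ger0_norm ?expR_ge0// ler_expR ltW//.
by rewrite (lt_le_trans tM)// ge_max xN yN.
Qed.

Lemma gronwall_zero (E dE : R -> R) (C r : R) : 0 < r -> continuous E -> E 0 =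
  0 ->
  (forall s, 0 <= E s) ->
  (forall s : R, 0 < s < r -> is_derive s 1 E (dE s)) ->
  (forall s, 0 < s < r -> dE s <= C * E s) -> E r = 0.
Proof.
move=> r0 cE E0 Ege0 d b.
pose F s := E s * expR (- (C * s)).
have cF : continuous F.
  move=> s; apply: cvgM; first exact: cE.
  apply: continuous_comp; last exact: continuous_expR.
  by apply: cvgN; apply: cvgM; [exact: cvg_cst|exact: cvg_id].
have [||| c c0r Ec] := @mvt_oc R F (fun s => (dE s - C * E s) * expR (- (C *
  s))) 0 r r0.
- exact: cF.
- by apply: cvg_at_right_filter; exact: cF.
- by move=> s /d ds; rewrite /F; derivative; ring.
- have : F r - F 0 <= 0.
    rewrite Ec subr0 mulr_le0_ge0 ?(ltW r0)// mulr_le0_ge0 ?expR_ge0//.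
    by rewrite subr_le0 b.
  rewrite /F E0 mul0r subr0 pmulr_lle0 ?expR_gt0// => Er.
  by apply/eqP; rewrite eq_le Er Ege0.
Qed.

(** Gronwall's lemma for the sum [E] of the squares of the differences of the
    unknowns and of their derivatives; the singular terms contribute
    [- 2 * d1 ^+ 2 / r - 2 * e1 ^+ 2 / r <= 0] to [E']. *)
Lemma radial_ode_unique (g g1 l l1 G G1 L L1 : R -> R) :
  radial_ode g g1 l l1 -> radial_ode G G1 L L1 -> g 0 = G 0 -> l 0 = L 0 ->
  forall r, 0 <= r -> g r = G r /\ l r = L r.
Proof.
move=> S T gG0 lL0 r; rewrite le_eqVlt => /predU1P[<-//|r0].
have cont (f df : R -> R) : (forall t : R, is_derive t 1 f (df t)) ->
  continuous f.
  by move=> d t; exact: is_derive_continuous (d t).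
have cg := cont _ _ (ode_dg S); have cl := cont _ _ (ode_dl S).
have cG := cont _ _ (ode_dg T); have cL := cont _ _ (ode_dl T).
have [M HM] : exists M : R, forall t, 0 <= t <= r ->
    [/\ g t <= M, G t <= M & `|L t| <= M].
  have [|c _ Hc] := @EVT_max R (fun t => `|g t| + `|G t| + `|L t|) 0 r (ltW r0).
    apply: continuous_subspaceT => t.
    apply: cvgD; first apply: cvgD.
    - by apply: cvg_norm; exact: cg.
    - by apply: cvg_norm; exact: cG.
    - by apply: cvg_norm; exact: cL.
  exists (`|g c| + `|G c| + `|L c|) => t t0r.
  have := Hc t; rewrite in_itv/= t0r => /(_ isT).
  have := normr_ge0 (g t); have := normr_ge0 (G t); have := normr_ge0 (L t).
  have := ler_norm (g t); have := ler_norm (G t).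
  by move=> *; split; lra.
have M0 : 0 <= M.
  have [|_ _ h] := HM r; first by rewrite lexx ltW.
  exact: le_trans h.
pose B := expR (2 * M).
have B0 : 0 < B by exact: expR_gt0.
pose d t := g t - G t; pose e t := l t - L t.
pose d1 t := g1 t - G1 t; pose e1 t := l1 t - L1 t.
pose p t := l t * expR (2 * g t) - L t * expR (2 * G t).
pose q t := expR (2 * g t) - expR (2 * G t).
have cd1 : continuous d1.
  by move=> t; apply: cvgB; [exact: ode_cg1 S t|exact: ode_cg1 T t].
have ce1 : continuous e1.
  by move=> t; apply: cvgB; [exact: ode_cl1 S t|exact: ode_cl1 T t].
pose E t := d t ^+ 2 + e t ^+ 2 + d1 t ^+ 2 + e1 t ^+ 2.
pose dE t := 2 * d t * d1 t + 2 * e t * e1 t +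
  2 * d1 t * (- (d1 t / t) - p t) + 2 * e1 t * (- (e1 t / t) - q t).
have E_r : E r = 0.
  apply: (@gronwall_zero E dE (1 + 3 * B + 2 * M * B) r r0).
  - have csq (f : R -> R) : continuous f -> continuous (fun t : R => f t ^+ 2 :
    R).
      move=> cf t; apply: (@continuous_comp _ _ _ f (fun y => y ^+ 2));
        first exact: cf.
      exact: exprn_continuous.
    move=> t; apply: cvgD; last exact: csq.
    apply: cvgD; last exact: csq.
    apply: cvgD; apply: csq => s; apply: cvgB.
    + exact: cg.
    + exact: cG.
    + exact: cl.
    + exact: cL.
  - rewrite /E /d /e /d1 /e1 gG0 lL0 (ode_g10 S) (ode_g10 T) (ode_l10 S)
    (ode_l10 T).
    by rewrite !subrr expr0n/= !addr0.
  - by move=> t; rewrite /E !addr_ge0 ?sqr_ge0.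
  - move=> t /andP[t0 _].
    have h1 := ode_dg S t; have h2 := ode_dl S t; have h3 := ode_dg1 S t0;
      have h4 := ode_dl1 S t0.
    have k1 := ode_dg T t; have k2 := ode_dl T t; have k3 := ode_dg1 T t0;
      have k4 := ode_dl1 T t0.
    rewrite /E /d /e /d1 /e1; derivative.
    rewrite /dE /d /e /d1 /e1 /p /q /=; field.
    by rewrite gt_eqF.
  - move=> t /andP[t0 tr].
    have [|gM GM LM] := HM t; first by rewrite !ltW.
    have q_le : `|q t| <= 2 * B * `|d t|.
      have := @expR_lipschitz (2 * M) (2 * g t) (2 * G t).
      rewrite !ler_pM2l// => /(_ gM GM);
        rewrite -mulrBr normrM [`|2|]ger0_norm//.
      by rewrite mulrA [expR _ * 2]mulrC.
    have p_le : `|p t| <= B * `|e t| + M * (2 * B * `|d t|).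
      rewrite (_ : p t = e t * expR (2 * g t) + L t * q t);
        last by rewrite /p /e /q; ring.
      apply: (le_trans (ler_normD _ _)); rewrite !normrM; apply: lerD.
        by rewrite mulrC ler_wpM2r// ger0_norm ?expR_ge0// ler_expR ler_pM2l.
      by apply: ler_pM.
    have t1 : 0 <= d1 t * (d1 t / t) by rewrite mulrA divr_ge0 ?sqr_ge0 ?ltW//
      -expr2 sqr_ge0.
    have t2 : 0 <= e1 t * (e1 t / t) by rewrite mulrA divr_ge0 ?sqr_ge0 ?ltW//
      -expr2 sqr_ge0.
    have n1 : - (d1 t * p t) <= `|d1 t| * (B * `|e t| + M * (2 * B * `|d t|)).
      by rewrite (le_trans (ler_norm _))// normrN normrM ler_wpM2l.
    have n2 : - (e1 t * q t) <= `|e1 t| * (2 * B * `|d t|).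
      by rewrite (le_trans (ler_norm _))// normrN normrM ler_wpM2l.
    rewrite /dE /E -(real_normK (num_real (d t))) -(real_normK (num_real (e
      t))).
    rewrite -(real_normK (num_real (d1 t))) -(real_normK (num_real (e1 t))).
    have m1 : d t * d1 t <= `|d t| * `|d1 t| by rewrite -normrM ler_norm.
    have m2 : e t * e1 t <= `|e t| * `|e1 t| by rewrite -normrM ler_norm.
    move: n1 n2 m1 m2 t1 t2 (normr_ge0 (d t)) (normr_ge0 (e t)) (normr_ge0 (d1
      t)) (normr_ge0 (e1 t)).
    move: `|d t| `|e t| `|d1 t| `|e1 t| => A Q D F n1 n2 m1 m2 t1 t2 A0 Q0 D0
      F0.
    have b1 : B * (2 * D * Q) <= B * (D ^+ 2 + Q ^+ 2).
      by rewrite ler_pM2l//; have := sqr_ge0 (D - Q); lra.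
    have b2 : M * B * (2 * D * A) <= M * B * (D ^+ 2 + A ^+ 2).
      rewrite ler_wpM2l ?mulr_ge0 ?(ltW B0)//.
      by have := sqr_ge0 (D - A); lra.
    have b3 : B * (2 * F * A) <= B * (F ^+ 2 + A ^+ 2).
      by rewrite ler_pM2l//; have := sqr_ge0 (F - A); lra.
    have b4 := sqr_ge0 (A - D); have b5 := sqr_ge0 (Q - F).
    have c1 : 0 <= B * A ^+ 2 by rewrite mulr_ge0 ?sqr_ge0 ?ltW.
    have c2 : 0 <= B * Q ^+ 2 by rewrite mulr_ge0 ?sqr_ge0 ?ltW.
    have c3 : 0 <= B * D ^+ 2 by rewrite mulr_ge0 ?sqr_ge0 ?ltW.
    have c4 : 0 <= B * F ^+ 2 by rewrite mulr_ge0 ?sqr_ge0 ?ltW.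
    have c5 : 0 <= M * (B * Q ^+ 2) by rewrite mulr_ge0.
    have c6 : 0 <= M * (B * F ^+ 2) by rewrite mulr_ge0.
    lra.
have : d r ^+ 2 = 0 /\ e r ^+ 2 = 0.
  have := sqr_ge0 (d r); have := sqr_ge0 (e r); have := sqr_ge0 (d1 r);
    have := sqr_ge0 (e1 r).
  by move: E_r; rewrite /E => *; split; lra.
rewrite -/(d r) -/(e r) => -[/eqP + /eqP]; rewrite !sqrf_eq0 /d /e !subr_eq0.
by move=> /eqP ? /eqP.
Qed.

End uniqueness.


Section restriction.
Context {R : realType}.
Implicit Types (f : R * R -> R) (c v z : R * R).

Lemma is_derive_restrict f c v (r l : R) : is_derive (c + r *: v) v f l ->
  is_derive r 1 (fun r => f (c + r *: v)) l.
Proof.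
move=> /is_derive_along_line d; apply/is_derive_along_line.
rewrite (_ : (fun t : R => _) = fun t : R => f (t *: v + (c + r *: v)))//.
by apply/funext => t; rewrite [t *: 1]mulr1 scalerDl addrCA.
Qed.

Lemma enorm_axes c (r y : R) :
  enorm (c + r *: e1 R + y *: e2 R - c) = Num.sqrt (r ^+ 2 + y ^+ 2).
Proof.
rewrite [_ - c]addrAC [c + _ - c]addrAC subrr add0r /enorm /= /GRing.scale/=.
by rewrite !mulr1 !mulr0 addr0 add0r.
Qed.

Lemma enorm_axis1 c (r : R) : 0 <= r -> enorm (c + r *: e1 R - c) = r.
Proof.
move=> r0; have := enorm_axes c r 0.
by rewrite scale0r addr0 expr0n/= addr0 sqrtr_sqr ger0_norm.
Qed.

Lemma enormZ (k : R) z : 0 <= k -> enorm (k *: z) = k * enorm z.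
Proof.
move=> k0; rewrite /enorm /= /GRing.scale/= !exprMn -mulrDr sqrtrM ?sqr_ge0//.
by rewrite sqrtr_sqr ger0_norm.
Qed.

(** A radial function is determined by its values on the half-axis. *)
Lemma radial_value f c z : radially_decreasing c f ->
  f z = f (c + enorm (z - c) *: e1 R).
Proof.
move=> [phi [_ fE]]; rewrite fE [RHS]fE enorm_axis1//.
by rewrite /enorm sqrtr_ge0.
Qed.

(** The profile of a smooth radial function along the first axis is even, and in
    terms of it the Laplacian is [g'' + g' / r]. *)
Lemma radial_restriction f c : smooth f -> radially_decreasing c f ->
  let g r := f (c + r *: e1 R) in
  exists g1 g2 : R -> R, [/\ forall r : R, is_derive r 1 g (g1 r),
    forall r : R, is_derive r 1 g1 (g2 r), g1 0 = 0 &
    forall r : R, 0 < r -> laplacian f (c + r *: e1 R) = g2 r + g1 r / r].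
Proof.
move=> sf rf g.
have [_ [df1 df2] cf1 cf2] := sf 2%N.
have [_ [df11 _] _ _] := cf1.
pose g1 r := 'D_(e1 R) f (c + r *: e1 R).
pose g2 r := 'D_(e1 R) ('D_(e1 R) f) (c + r *: e1 R).
have dg (r : R) : is_derive r 1 g (g1 r).
  by apply: is_derive_restrict; exact: derivableP.
have dg1 (r : R) : is_derive r 1 g1 (g2 r).
  exact: is_derive_restrict (derivableP (df11 _)).
have geven r : g (- r) = g r.
  have [phi [_ fE]] := rf; rewrite /g !fE; congr phi.
  have := enorm_axes c r 0; have := enorm_axes c (- r) 0.
  by rewrite !scale0r !addr0 sqrrN => -> ->.
exists g1, g2; split => //.
  have d0 : is_derive (0 : R) 1 (fun r => g (- r)) (g1 (- 0) * - 1).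
    by eapply is_derive_compf; [exact: dg|isd].
  have /funext gE : (fun r => g (- r)) =1 g by [].
  rewrite gE in d0; have [_ e] := d0; have [_ e'] := dg 0.
  by move: e; rewrite e' oppr0 mulrN1 => /eqP;
    rewrite -addr_eq0 -mulr2n mulrn_eq0/= => /eqP.
move=> r r0; rewrite /laplacian -/(g2 r); congr (_ + _).
pose rho y := Num.sqrt (r ^+ 2 + y ^+ 2).
have q0 y : 0 < r ^+ 2 + y ^+ 2 by rewrite ltr_pwDl ?exprn_gt0// sqr_ge0.
have rho0 y : 0 < rho y by rewrite sqrtr_gt0.
have drho (y : R) : is_derive y 1 rho (y / rho y).
  have d : is_derive y 1 (fun y : R => r ^+ 2 + y ^+ 2) (2 * y).
    by derivative; rewrite /=; ring.
  apply: is_derive_eqr; first exact: (@is_derive_compf R R Num.sqrt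
    (fun y => r ^+ 2 + y ^+ 2) y _ _ _ (is_derive1_sqrt (q0 y)) d).
  by rewrite -/(rho y); field; rewrite gt_eqF.
have fE y : f (c + r *: e1 R + y *: e2 R) = g (rho y).
  have [phi [_ E]] := rf.
  by rewrite /g !E enorm_axis1 ?(ltW (rho0 y))// enorm_axes.
have D2 y : 'D_(e2 R) f (c + r *: e1 R + y *: e2 R) = g1 (rho y) * (y / rho y).
  have d : is_derive y 1 (fun y => f (c + r *: e1 R + y *: e2 R))
      ('D_(e2 R) f (c + r *: e1 R + y *: e2 R)).
    by apply: is_derive_restrict; exact: derivableP.
  have d' : is_derive y 1 (fun y => f (c + r *: e1 R + y *: e2 R)) (g1 (rho y)
    * (y / rho y)).
    rewrite (_ : (fun y => _) = fun y => g (rho y)); last by apply/funext.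
    by apply: is_derive_compf (drho y); exact: dg.
  by have [_ <-] := d; have [_ ->] := d'.
have [_ [_ df22] _ _] := cf2.
have d : is_derive (0 : R) 1 (fun y => 'D_(e2 R) f (c + r *: e1 R + y *: e2 R))
    ('D_(e2 R) ('D_(e2 R) f) (c + r *: e1 R)).
  have d' : is_derive (c + r *: e1 R + 0 *: e2 R) (e2 R) ('D_(e2 R) f)
      ('D_(e2 R) ('D_(e2 R) f) (c + r *: e1 R)).
    by rewrite scale0r addr0; exact: derivableP.
  exact: is_derive_restrict d'.
have rho00 : rho 0 = r by rewrite /rho expr0n/= addr0 sqrtr_sqr gtr0_norm.
have d' : is_derive (0 : R) 1 (fun y => 'D_(e2 R) f (c + r *: e1 R + y *: e2
  R)) (g1 r / r).
  rewrite (_ : (fun y => _) = fun y => g1 (rho y) * (y * (rho y)^-1));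
    last by apply/funext.
  have h1 : is_derive (0 : R) 1 (fun y => g1 (rho y)) (g2 (rho 0) * (0 / rho
    0)).
    by apply: is_derive_compf (drho 0); exact: dg1.
  have h2 : is_derive (0 : R) 1 (fun y => (rho y)^-1) (- (0 / rho 0) / rho 0 ^+
    2).
    by apply: is_derive_invf => //; rewrite gt_eqF.
  derivative; rewrite rho00; ring.
by have [_ <-] := d; have [_ ->] := d'.
Qed.

Lemma radial_solution_ode (kappa Ks : R) (u K : R * R -> R) c :
  radial_solution kappa Ks u K c ->
  exists g1 l1 : R -> R,
    radial_ode (fun r => u (c + r *: e1 R)) g1 (fun r => K (c + r *: e1 R)) l1.
Proof.
move=> S.
have [g1 [g2 [dg dg1 g10 gL]]] := radial_restriction (u_smooth S) (u_radial S).
have [l1 [l2 [dl dl1 l10 lL]]] := radial_restriction (K_smooth S) (K_radial S).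
exists g1, l1; split=> //.
- by move=> r; exact: is_derive_continuous (dg1 r).
- by move=> r; exact: is_derive_continuous (dl1 r).
- move=> r r0; apply: is_derive_eqr (dg1 r) _.
  by have := u_eq S (c + r *: e1 R); rewrite gL// => <-; ring.
- move=> r r0; apply: is_derive_eqr (dl1 r) _.
  by have := K_eq S (c + r *: e1 R); rewrite lL// => <-; ring.
Qed.

Lemma radial_ode_scale (k : R) (g g1 l l1 : R -> R) : 0 < k ->
  radial_ode g g1 l l1 ->
  radial_ode (fun r => g (k * r) + ln k) (fun r => k * g1 (k * r))
    (fun r => l (k * r)) (fun r => k * l1 (k * r)).
Proof.
move=> k0 S.
have dk (r : R) : is_derive r 1 (fun r : R => k * r) k by derivative; ring.
have ck : continuous (fun r : R => k * r) by move=> r;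
  exact: is_derive_continuous (dk r).
have dc (f : R -> R) (r l' : R) : is_derive (k * r) 1 f l' ->
    is_derive r 1 (fun r => f (k * r)) (l' * k).
  by move=> d; exact: is_derive_compf d (dk r).
have expE r : expR (2 * (g (k * r) + ln k)) = k ^+ 2 * expR (2 * g (k * r)).
  by rewrite mulrDr expRD mulrC mulrDl mul1r expRD lnK ?posrE// expr2.
have kn : k != 0 by rewrite gt_eqF.
split.
- move=> r; have d := dc _ _ _ (ode_dg S (k * r)); derivative; ring.
- move=> r; apply: is_derive_eqr (dc _ _ _ (ode_dl S (k * r))) _; ring.
- move=> r; apply: cvgM; first exact: cvg_cst.
  by apply: continuous_comp; [exact: ck|exact: (ode_cg1 S)].
- move=> r; apply: cvgM; first exact: cvg_cst.
  by apply: continuous_comp; [exact: ck|exact: (ode_cl1 S)].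
- by rewrite mulr0 (ode_g10 S) mulr0.
- by rewrite mulr0 (ode_l10 S) mulr0.
- move=> r r0; have kr0 : 0 < k * r by rewrite mulr_gt0.
  have d := dc _ _ _ (ode_dg1 S kr0); derivative; rewrite expE.
  by field; rewrite kn gt_eqF.
- move=> r r0; have kr0 : 0 < k * r by rewrite mulr_gt0.
  have d := dc _ _ _ (ode_dl1 S kr0); derivative; rewrite expE.
  by field; rewrite kn gt_eqF.
Qed.

(** The parameter [k] matches the values of [v] and of the rescaled [u] at the
    centers; the values of [K] and [L] there agree by hypothesis. *)
Lemma radial_solution_unique (kappa kappa' Ks : R) (u K v L : R * R -> R) xs ys
  :
  radial_solution kappa Ks u K xs -> radial_solution kappa' Ks v L ys ->
  exists2 k : R, 0 < k & forall z, v z = u (xs + k *: (z - ys)) + ln k /\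
    L z = K (xs + k *: (z - ys)).
Proof.
move=> S T.
have [g1 [l1 OS]] := radial_solution_ode S;
  have [h1 [m1 OT]] := radial_solution_ode T.
pose k := expR (v ys - u xs).
have k0 : 0 < k by exact: expR_gt0.
exists k => // z.
have OS' := radial_ode_scale k0 OS.
have U := radial_ode_unique OT OS'.
have e0 : 0 <= enorm (z - ys) by exact: sqrtr_ge0.
have [||E1 E2] := U _ _ _ e0.
- by rewrite mulr0 !scale0r !addr0 /k expRK addrC subrK.
- by rewrite mulr0 !scale0r !addr0 (K_center S) (K_center T).
have nE : enorm (xs + k *: (z - ys) - xs) = k * enorm (z - ys).
  by rewrite addrAC subrr add0r enormZ// ltW.
rewrite (radial_value z (u_radial T)) (radial_value z (K_radial T)) E1 E2.
by rewrite (radial_value (xs + k *: (z - ys)) (u_radial S)) (radial_value (xs +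
  k *: (z - ys)) (K_radial S)) nE.
Qed.

End restriction.


(** * Existence and uniqueness *)

Lemma profile_solution (R : realType) (al be Ks : R) (a b x y : R -> R) :
  radial_profile al be Ks a b x y ->
  radial_solution (2 * pi * (1 + al)) Ks
    (fun z => a (sqnorm z)) (fun z => b (sqnorm z)) 0.
Proof.
move=> P; split.
- by apply: smooth_radial => n; case: (half_class_profile P n).
- by apply: smooth_radial => n; case: (half_class_profile P n).
- apply: (radially_decreasing_sqnorm (profile_a P) (profile_da P)) => s s0.
  by rewrite pmulr_llt0 ?invr_gt0 ?mulr_gt0// subr_lt0 (profile_x1 P).
- apply: (radially_decreasing_sqnorm (profile_b P) (profile_db P)) => s s0.
  by rewrite pmulr_llt0 ?invr_gt0 ?mulr_gt0// oppr_lt0 (profile_ygt0 P).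
- by move=> z; case: (laplacian_profile P z).
- by move=> z; case: (laplacian_profile P z).
- exact: integrable_curvature P.
- exact: integral_curvature P.
- by rewrite /sqnorm/= expr0n addr0 (profile_b0 P).
Qed.

Theorem theorem1p2 (R : realType) (kappa : R)
    (hkappa : 2 * pi < kappa < 4 * pi) :
  exists (Kstar : R) (u K : R * R -> R) (xs : R * R),
    [/\ 0 < Kstar,
        radial_solution kappa Kstar u K xs &
        forall (v L : R * R -> R) (ys : R * R),
          radial_solution kappa Kstar v L ys ->
          exists2 k : R, 0 < k &
            forall x : R * R,
              v x = u (xs + k *: (x - ys)) + ln k /\
              L x = K (xs + k *: (x - ys))].
Proof.
have pi0 : 0 < 2 * pi :> R by rewrite mulr_gt0// pi_gt0.
pose al := kappa / (2 * pi) - 1.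
have kE : 2 * pi * (1 + al) = kappa by rewrite /al addrC subrK mulrC divfK//
  gt_eqF.
have al01 : 0 < al < 1.
  have /andP[k1 k2] := hkappa; apply/andP; split.
    by rewrite subr_gt0 ltr_pdivlMr// mul1r.
  by rewrite ltrBlDr ltr_pdivrMr//; apply: lt_le_trans k2 _; lra.
have al21 : 0 < 2 * (1 - al ^+ 2).
  have /andP[al0 al1] := al01.
  by rewrite mulr_gt0// subr_gt0 expr_lt1// ltW.
pose be := Num.sqrt (2 * (1 - al ^+ 2)).
have be0 : 0 < be by rewrite sqrtr_gt0.
have beE : be ^+ 2 = 2 * (1 - al ^+ 2) by rewrite sqr_sqrtr// ltW.
have [Ks [a [b [x [y P]]]]] := exists_radial_profile al01 be0 beE.
have S := profile_solution P; rewrite kE in S.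
exists Ks, (fun z => a (sqnorm z)), (fun z => b (sqnorm z)), 0; split => //.
  exact: profile_Ks P.
by move=> v L ys T; exact: radial_solution_unique S T.
Qed.
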